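(* For all $m,n\in\mathbb{N}$ there is a non-adaptive monotonicity tester for functions $f\colon[m]^n\to\{0,1\}$ with respect to the uniform measure $U^{\otimes n}$ on $[m]^n$ that makes $\tilde{O}(\sqrt{n}\,m^3/\varepsilon^2)$ queries; i.e., a non-adaptive randomized algorithm with oracle access to $f$ that makes this many queries, accepts with probability $1$ every monotone $f$, and rejects with probability at least $2/3$ every $f$ that is $\varepsilon$-far from monotone with respect to $U^{\otimes n}$.
   Context: $[m]=\{0,1,\ldots,m-1\}$ with its usual order, and $[m]^n$ carries the coordinatewise partial order ($x\le y$ iff $x_i\le y_i$ for all $i$). $f$ is monotone if $x\le y$ implies $f(x)\le f(y)$. For a probability measure $\mu$ on $[m]^n$, $\varepsilon(f;\mu)=\min_{g\text{ monotone}}\mu(\{x:f(x)\ne g(x)\})$ and $f$ is $\varepsilon$-far from monotone if $\varepsilon(f;\mu)\ge \varepsilon$. $U$ is the uniform distribution on $[m]$. $\tilde{O}(\cdot)$ hides factors polylogarithmic in $n,m,1/\varepsilon$. *)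

(* Defs.v *)
From HB Require Import structures.
From mathcomp Require Import all_boot all_order all_algebra.
From mathcomp Require Import reals exp.
Set Implicit Arguments.
Unset Strict Implicit.
Unset Printing Implicit Defensive.
Import Order.TTheory GRing.Theory Num.Theory.
Local Open Scope ring_scope.

Record fdist (R : realType) (T : finType) := FDist {
  pmf :> T -> R;
  pmf_ge0 : forall x, 0 <= pmf x;
  pmf_sum1 : \sum_x pmf x = 1 }.

Definition prob (R : realType) (T : finType) (mu : fdist R T) (A : pred T) : R :=
  \sum_(x | A x) mu x.

Section Uniform.
Variables (R : realType) (m : nat) (m_gt0 : (0 < m)%N).

Definition uniform_pmf (i : 'I_m) : R := m%:R^-1.

Lemma uniform_pmf_ge0 i : 0 <= uniform_pmf i.
Proof. by rewrite invr_ge0 ler0n. Qed.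

Lemma uniform_pmf_sum1 : \sum_i uniform_pmf i = 1.
Proof.
rewrite sumr_const card_ord -[LHS]mulr_natl.
by rewrite mulfV // pnatr_eq0 -lt0n.
Qed.

Definition uniform : fdist R 'I_m := FDist uniform_pmf_ge0 uniform_pmf_sum1.
End Uniform.

Section Product.
Variables (R : realType) (T : finType) (mu : fdist R T) (n : nat).

Definition prod_pmf (x : {ffun 'I_n -> T}) : R := \prod_i mu (x i).

Lemma prod_pmf_ge0 x : 0 <= prod_pmf x.
Proof. by apply: prodr_ge0 => i _; apply: pmf_ge0. Qed.

Lemma prod_pmf_sum1 : \sum_x prod_pmf x = 1.
Proof.
rewrite -(bigA_distr_bigA (fun=> mu)) big1 // => i _; exact: pmf_sum1.
Qed.

Definition fdist_prod : fdist R {ffun 'I_n -> T} :=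
  FDist prod_pmf_ge0 prod_pmf_sum1.
End Product.

Notation grid m n := {ffun 'I_n -> 'I_m}.
Notation boolfun m n := {ffun grid m n -> bool}.

Definition grid_le m n (x y : grid m n) : bool := [forall i, (x i <= y i)%N].

(* On values in {0,1}, [b ==> c] is [b <= c]. *)
Definition monotone m n (f : boolfun m n) : bool :=
  [forall x, forall y, grid_le x y ==> (f x ==> f y)].

Definition disagreement (R : realType) m n (mu : fdist R (grid m n))
    (f g : boolfun m n) : R :=
  prob mu [pred x | f x != g x].

(* The default value 1 of the iterated minimum is harmless: it bounds every
   disagreement and there is a monotone g, see [dist_monotoneP]. *)
Definition dist_monotone (R : realType) m n (mu : fdist R (grid m n))
    (f : boolfun m n) : R :=
  \big[Num.min/1]_(g : boolfun m n | monotone g) disagreement mu f g.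

Lemma monotone_false m n : monotone ([ffun=> false] : boolfun m n).
Proof. by apply/forallP => x; apply/forallP => y; rewrite !ffunE implybT. Qed.

Lemma disagreement_le1 (R : realType) m n (mu : fdist R (grid m n))
  (f g : boolfun m n) : disagreement mu f g <= 1.
Proof.
rewrite -(pmf_sum1 mu) /disagreement /prob.
rewrite [leRHS](bigID [pred x | f x != g x]) /= lerDl.
by apply: sumr_ge0 => x _; apply: pmf_ge0.
Qed.

Lemma dist_monotoneP (R : realType) m n (mu : fdist R (grid m n))
    (f : boolfun m n) :
  (exists2 g, monotone g & dist_monotone mu f = disagreement mu f g) /\
  (forall g, monotone g -> dist_monotone mu f <= disagreement mu f g).
Proof.
split; last by move=> g gm; apply: bigmin_le_cond.
have [g gm eg] := @eq_bigmin _ _ _ (1 : R) _ (@monotone m n) (disagreement mu f)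
  (monotone_false m n) (fun g _ => disagreement_le1 mu f g).
by exists g; first exact: gm.
Qed.

Definition far_from_monotone (R : realType) m n (mu : fdist R (grid m n))
    (eps : R) (f : boolfun m n) : Prop :=
  eps <= dist_monotone mu f.

(* A deterministic non-adaptive algorithm: a list of q query points, fixed
   before any answer is seen, and the verdict (true = accept) for each vector
   of answers.  There are finitely many of these, so a non-adaptive randomized
   algorithm is a distribution over them. *)
Definition det_algo m n q : finType :=
  ({ffun 'I_q -> grid m n} * {ffun {ffun 'I_q -> bool} -> bool})%type.

Definition accepts m n q (f : boolfun m n) (A : det_algo m n q) : bool :=
  A.2 [ffun j => f (A.1 j)].

Definition nonadaptive_algo (R : realType) m n q := fdist R (det_algo m n q).

Definition monotonicity_tester (R : realType) m n q (mu : fdist R (grid m n))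
    (eps : R) (P : nonadaptive_algo R m n q) : Prop :=
  (forall f, monotone f -> prob P [pred A | accepts f A] = 1) /\
  (forall f, far_from_monotone mu eps f ->
     2 / 3 <= prob P [pred A | ~~ accepts f A]).

(* The k-th powers of this quantity are the factors hidden by the soft O; the
   shifts by 1 keep it above 1 for m, n >= 1, so that C * log_factor ^+ k
   ranges, up to domination, over all polylogarithmic factors in n, m, 1/eps. *)
Definition log_factor (R : realType) (n m : nat) (eps : R) : R :=
  ln (1 + n%:R) + ln (1 + m%:R) + ln (1 + eps^-1).

(* Main.v *)
Require Import Defs.
From HB Require Import structures.
From mathcomp Require Import all_boot all_order all_algebra.
From mathcomp Require Import reals exp.
From mathcomp Require Import zify ring lra.
Set Implicit Arguments.
Unset Strict Implicit.
Unset Printing Implicit Defensive.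
Import Order.TTheory GRing.Theory Num.Theory.
Local Open Scope ring_scope.

(* A partial matching of the values [0, ..., m-1], applied in every coordinate,
   splits the grid into Boolean cubes.  Sorting [f] along the matchings
   [a <-> s - a] between the two halves of dyadic blocks, coarse blocks first,
   makes [f] monotone after O(m log m) rounds, so an eps-far function is moved
   by eps / O(m log m) by a single matching.

   For one matching a directed Talagrand inequality holds.  Sorting [f] along a
   random set [A] of coordinates gives, at each point [x], a Boolean function of
   [A] whose boundary at every [A] is paid for by the violated edges of [f];
   payments are carried along while sorting without increasing the sum of the
   square roots.  The undirected inequality for this function, applied to the
   coordinates surviving successive random halvings, bounds the distance from
   [f] to its sorted version by a logarithmic factor times the sum over [x] of
   sqrt (number of violated edges charged to [x]), for every way of charging
   each violated edge to one of its endpoints.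

   The cheapest way of charging yields many points with about K violated edges
   such that no point is hit by more than O(K) of these edges.  A random upward
   (or downward) walk moving each coordinate with probability about
   |A| / (N sqrt n) crosses one of these edges and is unlikely to see [f] change
   anywhere else, because the total influence is O(sqrt n) unless single edges
   already reveal a violation. *)

(** * Real inequalities *)

Section RealInequalities.
Variable R : rcfType.
Implicit Types a b c d p q : R.

(** The triangle inequality for the Euclidean norm of the plane. Squaring reduces it to
    Cauchy-Schwarz, that is, to [(a d - b c)^2 >= 0]. *)
Lemma sqrtD_hypot a b c d :
  Num.sqrt ((a + c) ^+ 2 + (b + d) ^+ 2) <=
  Num.sqrt (a ^+ 2 + b ^+ 2) + Num.sqrt (c ^+ 2 + d ^+ 2).
Proof.
have hab : 0 <= a ^+ 2 + b ^+ 2 by rewrite addr_ge0 ?sqr_ge0.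
have hcd : 0 <= c ^+ 2 + d ^+ 2 by rewrite addr_ge0 ?sqr_ge0.
rewrite -[leRHS]ger0_norm ?addr_ge0 ?sqrtr_ge0// -sqrtr_sqr ler_sqrt ?sqr_ge0//.
rewrite [leRHS]sqrrD !sqr_sqrtr// -sqrtrM//.
suff : a * c + b * d <= Num.sqrt ((a ^+ 2 + b ^+ 2) * (c ^+ 2 + d ^+ 2)).
  by move=> h; lra.
apply: le_trans (ler_norm _) _; rewrite -sqrtr_sqr ler_sqrt ?mulr_ge0//.
have := sqr_ge0 (a * d - b * c); nra.
Qed.

(* [G t = t (1 - t)] satisfies [G G'' >= -1], which makes it a subsolution of
   the two-point inequality behind Talagrand's boundary inequality. *)
Lemma two_point_variance a b : 0 <= a <= 1 -> 0 <= b <= 1 ->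
  2 * ((a + b) / 2 * (1 - (a + b) / 2)) <=
  Num.sqrt ((a * (1 - a) + b * (1 - b)) ^+ 2 + (a - b) ^+ 2).
Proof.
move=> /andP[a0 a1] /andP[b0 b1].
pose G (t : R) := t * (1 - t); rewrite -!/(G _).
have G_ge0 t : 0 <= t -> t <= 1 -> 0 <= G t by move=> *; rewrite mulr_ge0// subr_ge0.
have Gm : 0 <= G ((a + b) / 2) by apply: G_ge0; lra.
have Gm2 : 0 <= 2 * G ((a + b) / 2) by lra.
rewrite -[leLHS](ger0_norm Gm2) -sqrtr_sqr ler_sqrt ?addr_ge0 ?sqr_ge0//.
have e : G a + G b = 2 * G ((a + b) / 2) - (a - b) ^+ 2 / 2 by rewrite /G; field.
have l4 : G ((a + b) / 2) <= 1 / 4.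
  rewrite /G; have := sqr_ge0 ((a + b) / 2 - 1 / 2); nra.
rewrite e; set g := G _ in Gm l4 *; set t := (a - b) ^+ 2.
have t0 : 0 <= t by rewrite sqr_ge0.
have : 0 <= t * (1 - 2 * g) by rewrite mulr_ge0//; lra.
have := sqr_ge0 t; nra.
Qed.

(** Concavity of the square root: of two pairs with equal sums, the more spread out one has the
    smaller sum of roots. After squaring, [c d <= p q] is [(p - c) (q - c) >= 0]. *)
Lemma sqrt_sum_spread p q c d : 0 <= c -> 0 <= d -> c + d = p + q -> c <= p -> c <= q ->
  Num.sqrt c + Num.sqrt d <= Num.sqrt p + Num.sqrt q.
Proof.
move=> c0 d0 e cp cq.
have p0 := le_trans c0 cp; have q0 := le_trans c0 cq.
rewrite -[leRHS]ger0_norm ?addr_ge0 ?sqrtr_ge0// -sqrtr_sqr.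
rewrite -[leLHS]ger0_norm ?addr_ge0 ?sqrtr_ge0// -sqrtr_sqr.
rewrite ler_sqrt ?sqr_ge0// !sqrrD !sqr_sqrtr//.
suff : Num.sqrt c * Num.sqrt d <= Num.sqrt p * Num.sqrt q by move=> h; lra.
rewrite -!sqrtrM// ler_sqrt ?mulr_ge0//.
have -> : d = p + q - c by lra.
have : 0 <= (p - c) * (q - c) by rewrite mulr_ge0// subr_ge0.
nra.
Qed.

(** The larger of [m] and [1 - m] is at least 1/2, so the smaller one is at most [2 m (1 - m)]. *)
Lemma le_min_variance c m S : 0 <= c -> 0 <= m <= 1 ->
  S <= 2 * (c * m) -> S <= 2 * (c * (1 - m)) -> S <= c * (4 * (m * (1 - m))).
Proof.
move=> c0 /andP[m0 m1] le1 le2; have [mh|mh] := lerP m (1 / 2).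
  have : 0 <= c * (m * (1 - 2 * m)) by rewrite !mulr_ge0//; lra.
  lra.
have : 0 <= c * ((1 - m) * (2 * m - 1)) by rewrite !mulr_ge0//; lra.
lra.
Qed.

Lemma sqrtD_le (a b : R) : 0 <= a -> 0 <= b ->
  Num.sqrt (a + b) <= Num.sqrt a + Num.sqrt b.
Proof.
move=> a0 b0; rewrite -[leRHS]ger0_norm ?addr_ge0 ?sqrtr_ge0// -sqrtr_sqr.
rewrite ler_sqrt ?sqr_ge0// sqrrD !sqr_sqrtr//.
by have := mulr_ge0 (sqrtr_ge0 a) (sqrtr_ge0 b); lra.
Qed.

(** The difference of the two roots is the reciprocal of their sum, and each root is at most
    [sqrt M]. *)
Lemma sqrt_pred_le (d M : nat) : (d.+1 <= M)%N ->
  Num.sqrt d%:R + (2 * Num.sqrt M%:R)^-1 <= Num.sqrt d.+1%:R :> R.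
Proof.
move=> dM; have M0 : (0 < M)%N by apply: leq_trans dM.
have s0 : 0 < Num.sqrt M%:R :> R by rewrite sqrtr_gt0 ltr0n.
have e1 : Num.sqrt d.+1%:R ^+ 2 = Num.sqrt d%:R ^+ 2 + 1 :> R.
  by rewrite !sqr_sqrtr ?ler0n// natr1.
have l1 : Num.sqrt d.+1%:R <= Num.sqrt M%:R :> R by rewrite ler_sqrt ?ler0n// ler_nat.
have l2 : Num.sqrt d%:R <= Num.sqrt d.+1%:R :> R by rewrite ler_sqrt ?ler0n// ler_nat.
have d0 : 0 <= Num.sqrt d%:R :> R by rewrite sqrtr_ge0.
rewrite -lerBrDl -[leLHS]mul1r ler_pdivrMr ?mulr_gt0//.
nra.
Qed.

End RealInequalities.

Section PowerInequalities.
Variable R : realFieldType.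
Implicit Types p y : R.

Lemma exp1D_le p (k : nat) : 0 <= p -> k%:R * p <= 1 ->
  (1 + p) ^+ k <= 1 + k%:R * p + (k%:R * p) ^+ 2.
Proof.
move=> p0; elim: k => [|k IH] kp; first by rewrite expr0 !mul0r expr0n /= !addr0.
have kp' : k%:R * p <= 1.
  by apply: le_trans kp; rewrite ler_wpM2r// ler_nat.
have kp0 : 0 <= k%:R * p by rewrite mulr_ge0.
rewrite exprSr; apply: le_trans (_ : _ <= (1 + k%:R * p + (k%:R * p) ^+ 2) * (1 + p)) _.
  by rewrite ler_pM2r ?IH//; lra.
rewrite -natr1; set a := k%:R * p in kp' kp0 *.
have -> : (k%:R + 1) * p = a + p by rewrite /a; ring.
have : 0 <= p * (a * (1 - a)) by rewrite !mulr_ge0// subr_ge0.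
have := mulr_ge0 p0 kp0; have := sqr_ge0 p; have := mulr_ge0 p0 (sqr_ge0 a).
have : a ^+ 2 * p <= a * p by rewrite ler_wpM2r// expr2 ler_piMl.
nra.
Qed.

Lemma exp1B_le p (k : nat) : 0 <= p -> p <= 1 -> k%:R * p <= 1 ->
  (1 - p) ^+ k <= 1 - k%:R * p + (k%:R * p) ^+ 2.
Proof.
move=> p0 p1; elim: k => [|k IH] kp; first by rewrite expr0 !mul0r expr0n /= oppr0 !addr0.
have kp' : k%:R * p <= 1.
  by apply: le_trans kp; rewrite ler_wpM2r// ler_nat.
have kp0 : 0 <= k%:R * p by rewrite mulr_ge0.
rewrite exprSr; apply: le_trans (_ : _ <= (1 - k%:R * p + (k%:R * p) ^+ 2) * (1 - p)) _.
  by rewrite ler_wpM2r ?IH// subr_ge0.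
rewrite -natr1; set a := k%:R * p in kp' kp0 *.
have -> : (k%:R + 1) * p = a + p by rewrite /a; ring.
have := mulr_ge0 p0 kp0; have := sqr_ge0 p; have := mulr_ge0 p0 (sqr_ge0 a).
nra.
Qed.

Lemma exp1D_le2 y (k : nat) : 0 <= y -> k%:R * y <= 1 / 2 -> (1 + y) ^+ k <= 2.
Proof.
(* This form is inductive, because [(1 + y) (1 - (k + 1) y) <= 1 - k y]. *)
move=> y0 ky; suff : (1 + y) ^+ k * (1 - k%:R * y) <= 1.
  have : 0 <= (1 + y) ^+ k by rewrite exprn_ge0//; lra.
  nra.
elim: k ky => [|k IH] ky; first by rewrite expr0 mul0r subr0 mulr1.
have ky' : k%:R * y <= 1 / 2 by apply: le_trans ky; rewrite ler_wpM2r// ler_nat.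
apply: le_trans (IH ky'); rewrite exprSr -mulrA ler_wpM2l//; first by rewrite exprn_ge0//; lra.
have k0 : 0 <= k%:R :> R by rewrite ler0n.
rewrite -natr1; have := mulr_ge0 k0 (sqr_ge0 y); have := sqr_ge0 y; nra.
Qed.

End PowerInequalities.

Lemma exists_ge_mean (R : realDomainType) (I : finType) (i0 : I) (F : I -> R) c :
  c <= \sum_i F i -> exists i, c <= #|I|%:R * F i.
Proof.
move=> le; have [/existsP[i ile]|/existsPn lt] := boolP [exists i, c <= #|I|%:R * F i].
  by exists i.
have : \sum_i #|I|%:R * F i < \sum_(i : I) c.
  apply: ltr_sum => [|i _]; last by rewrite ltNge.
  by apply/hasP; exists i0; rewrite ?mem_index_enum.
rewrite -mulr_sumr sumr_const -[c *+ _]mulr_natl ltNge ler_wpM2l ?ler0n//.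
Qed.

(** The least [t] with [2^-t <= M] works: [t - 1] fails, and [M < 1] excludes [t = 0]. *)
Lemma exists_dyadic (R : realFieldType) (M : R) l : M < 1 -> (2 ^+ l)^-1 <= M ->
  exists2 t, (t <= l)%N & (2 ^+ t)^-1 <= M <= 2 * (2 ^+ t)^-1.
Proof.
move=> M1 lM; have ex : exists t, (2 ^+ t)^-1 <= M by exists l.
case: (ex_minnP ex) => t tM tmin; exists t; first exact: tmin.
rewrite tM /=; case: t tM tmin => [|t] tM tmin; first by move: tM; rewrite expr0 invr1; lra.
rewrite exprS invfM mulrA mulfV ?pnatr_eq0// mul1r leNgt; apply/negP => /ltW /tmin.
by rewrite ltnn.
Qed.

(** * Sorting along a matching, and payments *)

Section Flips.
Variables (T : finType) (n : nat) (sg : T -> T) (lo : pred T).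
Hypothesis sgK : involutive sg.
Hypothesis lo_sg : forall a, lo a -> ~~ lo (sg a).
Local Notation X := {ffun 'I_n -> T}.
Local Notation fn := {ffun X -> bool}.
Implicit Types (i j : 'I_n) (x y : X) (h u : fn).

(** [sg] is read as a matching of values whose fixed points are unmatched, and [lo] as marking the
    lower end of each matched pair. *)
Definition flip i x : X := [ffun j => if j == i then sg (x j) else x j].
Definition lower i x := lo (x i).
Definition upper i x := lo (sg (x i)).

Lemma flipK i : involutive (flip i).
Proof. by move=> x; apply/ffunP => j; rewrite !ffunE; case: eqP => // _; rewrite sgK. Qed.

Lemma flipC i j x : flip i (flip j x) = flip j (flip i x).
Proof. by apply/ffunP => k; rewrite !ffunE; do 2!case: eqP. Qed.

Lemma lower_flip i x : lower i (flip i x) = upper i x.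
Proof. by rewrite /lower /upper ffunE eqxx. Qed.

Lemma upper_flip i x : upper i (flip i x) = lower i x.
Proof. by rewrite /lower /upper ffunE eqxx sgK. Qed.

Lemma lower_flipN i j x : i != j -> lower i (flip j x) = lower i x.
Proof. by move=> ij; rewrite /lower ffunE (negbTE ij). Qed.

Lemma upper_flipN i j x : i != j -> upper i (flip j x) = upper i x.
Proof. by move=> ij; rewrite /upper ffunE (negbTE ij). Qed.

Lemma lower_upperF i x : lower i x -> upper i x = false.
Proof. by move=> /lo_sg/negbTE. Qed.

Variant position_spec i x : bool -> bool -> bool -> bool -> Type :=
| PositionLower of lower i x : position_spec i x true false false true
| PositionUpper of upper i x : position_spec i x false true true false
| PositionNone : position_spec i x false false false false.

Lemma positionP i x :
  position_spec i x (lower i x) (upper i x) (lower i (flip i x)) (upper i (flip i x)).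
Proof.
rewrite lower_flip upper_flip.
case hl: (lower i x); first by rewrite lower_upperF//; constructor.
by case hu: (upper i x); constructor.
Qed.

Definition srt i h : fn := [ffun x =>
  if lower i x then h x && h (flip i x)
  else if upper i x then h x || h (flip i x) else h x].

Definition sorts (s : seq 'I_n) h := foldl (fun h i => srt i h) h s.

Lemma sorts_cat s t h : sorts (s ++ t) h = sorts t (sorts s h).
Proof. exact: foldl_cat. Qed.

Definition is_sorted i h := srt i h == h.

Lemma is_sortedP i h :
  reflect (forall x, lower i x -> h x -> h (flip i x)) (is_sorted i h).
Proof.
apply: (iffP eqP) => [<- x|hs].
  by rewrite !ffunE flipK; case: positionP => // _ _ /andP[-> ->].
apply/ffunP => x; rewrite ffunE.
case: positionP => [l|u|]//; first by move: (hs _ l); case: (h x) => //= ->.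
by move: (hs (flip i x)); rewrite lower_flip u flipK; case: (h (flip i x)) => [->|]; rewrite ?orbF.
Qed.

Lemma srt_sorted i h : is_sorted i (srt i h).
Proof.
apply/is_sortedP => x; rewrite !ffunE flipK.
by case: positionP => // _ _ /andP[-> ->].
Qed.

(** On a square spanned by directions [i] and [j], sorting along [j] takes minima and maxima of
    values already ordered along [i], and these remain ordered. *)
Lemma srt_preserves i j h : is_sorted i h -> is_sorted i (srt j h).
Proof.
have [->|ij] := eqVneq i j; first by rewrite srt_sorted.
move/is_sortedP => hs; apply/is_sortedP => x l; rewrite !ffunE.
rewrite lower_flipN 1?eq_sym// upper_flipN 1?eq_sym// (flipC j i).
have h1 := hs x l; have h2 := hs (flip j x); rewrite lower_flipN// in h2.
case: ifP => _; first by case/andP => /h1 -> /(h2 l) ->.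
case: ifP => _; last exact: h1.
by case/orP => [/h1|/(h2 l)] ->; rewrite ?orbT.
Qed.

Lemma sorts_preserves i s h : is_sorted i h -> is_sorted i (sorts s h).
Proof. by elim: s h => //= j s IH h hi; apply/IH/srt_preserves. Qed.

Lemma sorts_sorted i s h : i \in s -> is_sorted i (sorts s h).
Proof.
elim: s h => //= j s IH h; rewrite in_cons => /orP[/eqP->|/IH//].
exact/sorts_preserves/srt_sorted.
Qed.

Lemma sorts_id s h : (forall i, i \in s -> is_sorted i h) -> sorts s h = h.
Proof.
elim: s => //= i s IH hs; rewrite (eqP (hs i _)) ?mem_head//.
by apply: IH => j js; apply: hs; rewrite in_cons js orbT.
Qed.

Definition hd h u : nat := #|[pred x | h x != u x]|.

Lemma hdE h u : hd h u = (\sum_x (h x != u x))%N.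
Proof. by rewrite /hd -sum1_card big_mkcond. Qed.

Lemma hdC h u : hd h u = hd u h.
Proof. by apply: eq_card => x; rewrite !inE eq_sym. Qed.

Lemma hdxx h : hd h h = 0%N.
Proof. by apply: eq_card0 => x; rewrite !inE eqxx. Qed.

Lemma hd_triangle u h h' : (hd h h' <= hd h u + hd u h')%N.
Proof.
rewrite !hdE -big_split; apply: leq_sum => x _.
by case: (h x) (u x) (h' x) => -[] [].
Qed.

Lemma sum_flip (V : nmodType) i (F : X -> V) : \sum_x F (flip i x) = \sum_x F x.
Proof.
rewrite [RHS](reindex_inj (h := flip i))//; exact: can_inj (flipK i).
Qed.

(** [flip i] permutes the points, so an inequality of sums may be checked on each pair [x],
    [flip i x]; summing over all [x] doubles both sides. *)
Lemma sum_flip_le (R : numDomainType) i (F G : X -> R) :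
  (forall x, F x + F (flip i x) <= G x + G (flip i x)) -> \sum_x F x <= \sum_x G x.
Proof.
move=> le; have /ler_sum : forall x : X, true -> F x + F (flip i x) <= G x + G (flip i x).
  by move=> x _.
move=> /(_ (index_enum _)); rewrite !big_split /= !sum_flip -!mulr2n.
by rewrite lerMn2r.
Qed.

Lemma hd_srt i h u : (hd (srt i h) (srt i u) <= hd h u)%N.
Proof.
rewrite !hdE -(ler_nat int) !natr_sum; apply: (@sum_flip_le _ i) => x.
rewrite -!natrD ler_nat !ffunE flipK.
by case: positionP => [_|_|]; case: (h x) (h (flip i x)) (u x) (u (flip i x)) => -[] [] [].
Qed.

Lemma hd_sorts s h u : (hd (sorts s h) (sorts s u) <= hd h u)%N.
Proof. by elim: s h u => //= i s IH h u; apply: leq_trans (IH _ _) (hd_srt i h u). Qed.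

(** [sorts t h] is sorted in every coordinate of [s], hence fixed by sorting along [s]. Sorting is a
    contraction, so [sorts s h] is as close to [sorts t h] as [h] is. *)
Lemma hd_sorts_order s t h : s =i t -> (hd h (sorts s h) <= 2 * hd h (sorts t h))%N.
Proof.
move=> st; have e : sorts t h = sorts s (sorts t h).
  by rewrite [RHS]sorts_id => [|i] //; rewrite st; apply: sorts_sorted.
apply: leq_trans (hd_triangle (sorts t h) _ _) _.
by rewrite mul2n -addnn leq_add2l hdC [X in hd _ X]e hd_sorts.
Qed.

(* How the payments [(a0, a1)] of a pair (lower, upper) of points with values
   [(h0, h1)] are redistributed when the pair gets sorted.  The rule looks only
   at one function, yet it preserves [compat] for two functions updated
   independently. *)
Definition pay_lower (h0 h1 a0 a1 : bool) :=
  if h0 then if h1 then a0 || a1 else a1 else if h1 then a0 else a0 && a1.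
Definition pay_upper (h0 h1 a0 a1 : bool) :=
  if h0 then if h1 then a0 && a1 else a0 else if h1 then a1 else a0 || a1.

Definition srt_pay i h u : fn := [ffun x =>
  if lower i x then pay_lower (h x) (h (flip i x)) (u x) (u (flip i x))
  else if upper i x then pay_upper (h (flip i x)) (h x) (u (flip i x)) (u x)
  else u x].

Definition compat h u h' u' := forall x, h x != h' x -> u x || u' x.

Lemma compat_srt i h u h' u' : compat h u h' u' ->
  compat (srt i h) (srt_pay i h u) (srt i h') (srt_pay i h' u').
Proof.
move=> c x; move: (c x) (c (flip i x)); rewrite !ffunE.
by case: positionP => [_|_|]; rewrite /pay_lower /pay_upper;
  case: (h x) (h (flip i x)) (h' x) (h' (flip i x)) => -[] [] [];
  case: (u x) (u (flip i x)) (u' x) (u' (flip i x)) => -[] [] [] //= H1 H2;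
  (try by have := H1 isT); (try by have := H2 isT).
Qed.

Definition violated i h x := [&& lower i x, h x & ~~ h (flip i x)].

Definition covers i h u := forall x, violated i h x -> u x || u (flip i x).

(** A check on the squares spanned by [i] and [j]. It allows the payments of the directions not yet
    treated to be carried through an induction on the list of directions. *)
Lemma covers_srt i j h u : i != j -> covers i h u -> covers i (srt j h) (srt_pay j h u).
Proof.
move=> ij c x; have ji : j != i by rewrite eq_sym.
move: (c x) (c (flip j x)); rewrite /violated !ffunE.
rewrite !(lower_flipN, upper_flipN)// (flipC j i).
case: (lower i x) => //=.
by case: positionP => [_|_|]; rewrite /pay_lower /pay_upper;
  case: (h x) (h (flip j x)) (h (flip i x)) (h (flip i (flip j x))) => -[] [] [];
  case: (u x) (u (flip j x)) (u (flip i x)) (u (flip i (flip j x))) => -[] [] [] //= H1 H2;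
  (try by have := H1 isT); (try by have := H2 isT).
Qed.

(** [h] and [srt i h] differ exactly at the endpoints of violated edges. There [srt_pay] swaps the
    two payments, so at each endpoint the old and new payments together include the payments of both
    ends. *)
Lemma compat_split i h u : covers i h u -> compat h u (srt i h) (srt_pay i h u).
Proof.
move=> c x; move: (c x) (c (flip i x)); rewrite /violated !ffunE !flipK.
by case: positionP => [_|_|]; rewrite /pay_lower /pay_upper ?eqxx//;
  case: (h x) (h (flip i x)) => -[];
  case: (u x) (u (flip i x)) => -[] //= H1 H2;
  (try by have := H1 isT); (try by have := H2 isT).
Qed.

End Flips.

(** * Talagrand's inequality for the sorted functions *)

Section Talagrand.
Variables (R : rcfType) (T : finType) (n : nat) (sg : T -> T) (lo : pred T).
Hypothesis sgK : involutive sg.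
Hypothesis lo_sg : forall a, lo a -> ~~ lo (sg a).
Local Notation X := {ffun 'I_n -> T}.
Local Notation fn := {ffun X -> bool}.
Local Notation flip := (flip sg).
Local Notation srt := (srt sg lo).
Local Notation sorts := (sorts sg lo).
Local Notation srt_pay := (srt_pay sg lo).
Local Notation covers := (covers sg lo).
Implicit Types (i j : 'I_n) (s t : seq 'I_n) (x : X) (h u : fn) (w : 'I_n -> fn).

Definition load t w x : nat := count (fun i => w i x) t.

(** On a pair of points, all directions at once have their payments kept, swapped, or replaced by
    conjunction and disjunction. In the last case the two counts become more spread out with the
    same sum, and [sqrt_sum_spread] applies. *)
Lemma load_srt_le i h w t :
  \sum_x Num.sqrt (load t (fun j => srt_pay i h (w j)) x)%:R <=
  \sum_x Num.sqrt (load t w x)%:R :> R.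
Proof.
apply: (@sum_flip_le _ _ _ sgK _ i) => x.
pose a0 j := w j x; pose a1 j := w j (flip i x).
have cI : (count (predI a0 a1) t + count (predU a0 a1) t = count a0 t + count a1 t)%N.
  by rewrite addnC count_predUI.
have c0 : (count (predI a0 a1) t <= count a0 t)%N by apply: sub_count => j /andP[].
have c1 : (count (predI a0 a1) t <= count a1 t)%N by apply: sub_count => j /andP[].
have spread : Num.sqrt (count (predI a0 a1) t)%:R + Num.sqrt (count (predU a0 a1) t)%:R <=
  Num.sqrt (count a0 t)%:R + Num.sqrt (count a1 t)%:R :> R.
  by apply: sqrt_sum_spread; rewrite ?ler0n ?ler_nat// -!natrD cI.
have loadE (v : 'I_n -> fn) (p : pred 'I_n) y : (forall j, v j y = p j) -> load t v y = count p t.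
  by move=> e; apply: eq_count => j; rewrite /= e.
rewrite [X in _ <= Num.sqrt X%:R + _](@loadE _ a0 x)//.
rewrite [X in _ <= _ + Num.sqrt X%:R](@loadE _ a1 (flip i x))//.
case l: (lower lo i x); last case u: (upper sg lo i x).
- have [p0 p1] : (forall j, srt_pay i h (w j) x = pay_lower (h x) (h (flip i x)) (a0 j) (a1 j))
    /\ (forall j, srt_pay i h (w j) (flip i x) = pay_upper (h x) (h (flip i x)) (a0 j) (a1 j)).
    by split=> j; rewrite ffunE ?flipK// ?lower_flip ?upper_flip// ?l ?lower_upperF.
  rewrite (loadE _ _ _ p0) (loadE _ _ _ p1) /pay_lower /pay_upper.
  by case: (h x) (h (flip i x)) => -[] //=; rewrite [leLHS]addrC.
- have [p0 p1] : (forall j, srt_pay i h (w j) x = pay_upper (h (flip i x)) (h x) (a1 j) (a0 j))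
    /\ (forall j, srt_pay i h (w j) (flip i x) = pay_lower (h (flip i x)) (h x) (a1 j) (a0 j)).
    by split=> j; rewrite ffunE ?flipK// ?lower_flip ?upper_flip// ?l ?u.
  rewrite (loadE _ _ _ p0) (loadE _ _ _ p1) /pay_lower /pay_upper.
  have eI : count (fun j => a1 j && a0 j) t = count (predI a0 a1) t.
    by apply: eq_count => j; rewrite /= andbC.
  have eU : count (fun j => a1 j || a0 j) t = count (predU a0 a1) t.
    by apply: eq_count => j; rewrite /= orbC.
  by case: (h x) (h (flip i x)) => -[] //=; rewrite ?eI ?eU// [leLHS]addrC.
- rewrite (@loadE _ a0 x); last by move=> j; rewrite ffunE l u.
  rewrite (@loadE _ a1 (flip i x))// => j.
  by rewrite ffunE lower_flip// upper_flip// l u.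
Qed.

(* Averages over the subsequences [A] of [s] of, respectively, the value at [x]
   of the function sorted along [A], of a payment carried along, and of the
   square root of a total payment. *)
Fixpoint mean_srt s h x : R :=
  if s is i :: s' then (mean_srt s' h x + mean_srt s' (srt i h) x) / 2
  else (h x)%:R.

Fixpoint mean_pay s h u x : R :=
  if s is i :: s' then (mean_pay s' h u x + mean_pay s' (srt i h) (srt_pay i h u) x) / 2
  else (u x)%:R.

Fixpoint mean_load s h w t x : R :=
  if s is i :: s' then
    (mean_load s' h w t x + mean_load s' (srt i h) (fun j => srt_pay i h (w j)) t x) / 2
  else Num.sqrt (load t w x)%:R.

Lemma mean_srt_itv s h x : 0 <= mean_srt s h x <= 1.
Proof.
elim: s h => [|i s IH] h /=; first by rewrite ler0n lern1 leq_b1.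
move: (IH h) (IH (srt i h)) => /andP[? ?] /andP[? ?]; apply/andP; split; lra.
Qed.

Lemma mean_pay_ge0 s h u x : 0 <= mean_pay s h u x.
Proof.
elim: s h u => [|i s IH] h u /=; first by rewrite ler0n.
by have := IH h u; have := IH (srt i h) (srt_pay i h u); lra.
Qed.

Lemma sum_mean_load s h w t :
  \sum_x mean_load s h w t x <= \sum_x Num.sqrt (load t w x)%:R.
Proof.
elim: s h w => [|i s IH] h w /=; first exact: lexx.
rewrite -mulr_suml big_split /=.
have := IH h w; have := IH (srt i h) (fun j => srt_pay i h (w j)).
by have := load_srt_le i h w t; lra.
Qed.

(** Without averaging this is [sqrt (N + u) = sqrt (sqrt N ^ 2 + u ^ 2)] for a bit [u]. Averaging
    preserves the bound by convexity of the Euclidean norm. *)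
Lemma mean_load_cons s h w i t x :
  Num.sqrt (mean_load s h w t x ^+ 2 + mean_pay s h (w i) x ^+ 2) <=
  mean_load s h w (i :: t) x.
Proof.
elim: s h w => [|j s IH] h w /=.
  rewrite sqr_sqrtr ?ler0n// ler_sqrt ?ler0n// addrC natrD lerD2r.
  by case: (w i x); rewrite ?expr0n ?expr1n.
have := IH h w; have := IH (srt j h) (fun k => srt_pay j h (w k)).
set a := mean_load s h w t x; set b := mean_pay s h _ x.
set c := mean_load s _ _ t x; set d := mean_pay s _ _ x => IH1 IH2.
have e : ((a + c) / 2) ^+ 2 + ((b + d) / 2) ^+ 2 =
  ((a + c) ^+ 2 + (b + d) ^+ 2) * (2^-1) ^+ 2 by field.
rewrite e sqrtrM ?addr_ge0 ?sqr_ge0// sqrtr_sqr ger0_norm ?invr_ge0//.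
rewrite ler_pM2r ?invr_gt0//.
by apply: le_trans (sqrtD_hypot _ _ _ _) _; apply: lerD.
Qed.

(** Compatibility survives sorting both functions along the same subsequence, so each difference of
    values in the average is matched by a payment. *)
Lemma mean_pay_compat s h u h' u' x : compat h u h' u' ->
  `|mean_srt s h x - mean_srt s h' x| <= mean_pay s h u x + mean_pay s h' u' x.
Proof.
elim: s h u h' u' => [|i s IH] h u h' u' c /=.
  have := c x; rewrite -natrD.
  case: (h x) (h' x) => -[] /= cx; rewrite ?subrr ?normr0 ?ler0n//;
  by move: (cx isT); rewrite ?subr0 ?sub0r ?normrN normr1 ler1n; case: (u x) (u' x) => -[].
have := IH _ _ _ _ c; have := IH _ _ _ _ (compat_srt sgK lo_sg (i := i) c).
rewrite !ler_norml => /andP[? ?] /andP[? ?]; apply/andP; split; lra.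
Qed.

(** Talagrand's inequality on the cube of subsequences of [s], for fixed [x]. The two halves in
    direction [i] are the functions obtained from [h] and from [srt i h]; their means differ by at
    most the two mean payments for [i]. The two-point inequality and the triangle inequality then
    combine the halves. *)
Lemma mean_load_variance s h w x : uniq s -> (forall i, i \in s -> covers i h (w i)) ->
  mean_srt s h x * (1 - mean_srt s h x) <= mean_load s h w s x.
Proof.
elim: s h w => [|i s IH] h w /=.
  by move=> _ _; case: (h x); rewrite ?subrr ?mulr0 ?mul0r sqrtr_ge0.
move=> /andP[is_ us] cov.
have cov0 j : j \in s -> covers j h (w j) by move=> js; apply: cov; rewrite in_cons js orbT.
have cov1 j : j \in s -> covers j (srt i h) (srt_pay i h (w j)).
  move=> js; apply: covers_srt => //; last exact: cov0.
  by apply: contraNneq is_ => <-.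
have IH0 := IH _ _ us cov0; have IH1 := IH _ (fun j => srt_pay i h (w j)) us cov1.
have L0 := mean_load_cons s h w i s x.
have L1 := mean_load_cons s (srt i h) (fun j => srt_pay i h (w j)) i s x.
have pays := mean_pay_compat s x (compat_split sgK lo_sg (cov i (mem_head _ _))).
have p0 := mean_pay_ge0 s h (w i) x.
have p1 := mean_pay_ge0 s (srt i h) (srt_pay i h (w i)) x.
have g0 := mean_srt_itv s h x; have g1 := mean_srt_itv s (srt i h) x.
rewrite /= in L1; move: pays p0 p1 g0 g1 L0 L1 IH0 IH1.
set a := mean_srt s h x; set b := mean_srt s (srt i h) x.
set p := mean_pay _ _ _ x; set q := mean_pay _ _ _ x.
set Q0 := mean_load _ _ _ s x; set Q1 := mean_load _ _ _ s x.
move=> pays p0 p1 g0 g1 L0 L1 IH0 IH1.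
rewrite -(ler_pM2l (ltr0n R 2)) [leRHS]mulrC mulfVK ?pnatr_eq0//.
apply: le_trans (two_point_variance g0 g1) _.
apply: le_trans _ (lerD L0 L1); apply: le_trans _ (sqrtD_hypot _ _ _ _).
rewrite ler_sqrt ?addr_ge0 ?sqr_ge0// lerD//.
  have v0 : 0 <= a * (1 - a) by case/andP: g0 => ? ?; rewrite mulr_ge0// subr_ge0.
  have v1 : 0 <= b * (1 - b) by case/andP: g1 => ? ?; rewrite mulr_ge0// subr_ge0.
  by rewrite ler_sqr ?nnegrE ?lerD ?addr_ge0//; lra.
by rewrite -real_normK ?num_real// ler_sqr ?nnegrE ?addr_ge0.
Qed.

Lemma sum_variance_le s h w : uniq s -> (forall i, i \in s -> covers i h (w i)) ->
  \sum_x mean_srt s h x * (1 - mean_srt s h x) <= \sum_x Num.sqrt (load s w x)%:R.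
Proof.
move=> us cov; apply: le_trans (sum_mean_load s h w s).
by apply: ler_sum => x _; apply: mean_load_variance.
Qed.

End Talagrand.

(** * The directed Talagrand inequality *)

Section DirectedTalagrand.
Variables (R : rcfType) (T : finType) (n : nat) (sg : T -> T) (lo : pred T).
Hypothesis sgK : involutive sg.
Hypothesis lo_sg : forall a, lo a -> ~~ lo (sg a).
Local Notation X := {ffun 'I_n -> T}.
Local Notation fn := {ffun X -> bool}.
Local Notation srt := (srt sg lo).
Local Notation sorts := (sorts sg lo).
Local Notation covers := (covers sg lo).
Local Notation mean_srt := (mean_srt R sg lo).
Implicit Types (i j : 'I_n) (s t : seq 'I_n) (x : X) (h u : fn) (w : 'I_n -> fn).
Implicit Types A B : {set 'I_n}.

(** Symmetric difference with the singleton of [i]: an involution exchanging the sets that contain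
    [i] with those that do not. *)
Definition toggle i A : {set 'I_n} := [set j | (j \in A) (+) (j == i)].

Lemma toggleK i : involutive (toggle i).
Proof. by move=> A; apply/setP => j; rewrite !inE -addbA addbb addbF. Qed.

Lemma in_toggle i A : (i \in toggle i A) = (i \notin A).
Proof. by rewrite inE eqxx addbT. Qed.

Lemma in_toggleN i j A : j != i -> (j \in toggle i A) = (j \in A).
Proof. by move=> ji; rewrite inE (negbTE ji) addbF. Qed.

Lemma sum_mem_half (F : {set 'I_n} -> R) i : (forall A, F (toggle i A) = F A) ->
  \sum_(A : {set 'I_n} | i \in A) F A = (\sum_A F A) / 2 /\
  \sum_(A : {set 'I_n} | i \notin A) F A = (\sum_A F A) / 2.
Proof.
move=> Fi.
have e : \sum_(A : {set 'I_n} | i \notin A) F A = \sum_(A : {set 'I_n} | i \in A) F A.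
  rewrite [RHS](reindex_inj (can_inj (toggleK i))) /=.
  by apply: eq_big => A; rewrite ?in_toggle.
have -> : \sum_A F A = \sum_(A : {set 'I_n} | i \in A) F A + \sum_(A : {set 'I_n} | i \in A) F A.
  by rewrite -{2}e (bigID (fun A : {set 'I_n} => i \in A)).
by rewrite e; move: (\sum_(A : {set 'I_n} | i \in A) F A) => S; split; field.
Qed.

Local Notation subs A s := [seq j <- s | j \in (A : {set 'I_n})].
Local Notation c := (#|{set 'I_n}|%:R : R).

Lemma subs_toggle i A s : i \notin s -> subs (toggle i A) s = subs A s.
Proof.
move=> is_; apply: eq_in_filter => j js; apply: in_toggleN.
by apply: contraNneq is_ => <-.
Qed.

Lemma mean_srtE s h x : uniq s ->
  c * mean_srt s h x = \sum_A (sorts (subs A s) h x)%:R.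
Proof.
elim: s h => [|i s IH] h /=; first by rewrite sumr_const -[RHS]mulr_natl.
move=> /andP[is_ us]; rewrite mulrA mulrDr !IH//.
rewrite [RHS](bigID (fun A : {set 'I_n} => i \in A)) /=.
have -> : \sum_(A : {set 'I_n} | i \in A) ((sorts (if i \in A then i :: subs A s else subs A s) h) x)%:R
  = \sum_(A : {set 'I_n} | i \in A) (sorts (subs A s) (srt i h) x)%:R :> R.
  by apply: eq_bigr => A ->.
have -> : \sum_(A : {set 'I_n} | i \notin A) ((sorts (if i \in A then i :: subs A s else subs A s) h) x)%:R
  = \sum_(A : {set 'I_n} | i \notin A) (sorts (subs A s) h x)%:R :> R.
  by apply: eq_bigr => A /negbTE->.
have [-> _] := @sum_mem_half (fun A => (sorts (subs A s) (srt i h) x)%:R) i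
  (fun A => congr1 (fun r => (sorts r (srt i h) x)%:R) (subs_toggle A is_)).
have [_ ->] := @sum_mem_half (fun A => (sorts (subs A s) h x)%:R) i
  (fun A => congr1 (fun r => (sorts r h x)%:R) (subs_toggle A is_)).
by rewrite -mulrDl addrC.
Qed.

Lemma sum_setC (F : {set 'I_n} -> R) : \sum_A F (~: A) = \sum_A F A.
Proof. by rewrite [RHS](reindex_inj (can_inj (@setCK _))). Qed.

(** At a point [x], the values for [A] and for its complement differ only if one of them is 1 and
    the other 0. The number of such [A] is thus at most twice the number of ones and twice the
    number of zeros, and the smaller of these is bounded by the variance. *)
Lemma sum_hd_split s h : uniq s ->
  \sum_A (hd (sorts (subs A s) h) (sorts (subs (~: A) s) h))%:R <=
  c * (4 * \sum_x mean_srt s h x * (1 - mean_srt s h x)).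
Proof.
move=> us; under eq_bigr do rewrite hdE natr_sum.
rewrite exchange_big !mulr_sumr; apply: ler_sum => x _ /=.
pose g A := sorts (subs A s) h x; set m := mean_srt s h x.
have c0 : 0 <= c by rewrite ler0n.
have m01 : 0 <= m <= 1 by apply: mean_srt_itv.
have gE : \sum_A (g A)%:R = c * m by rewrite mean_srtE.
have gN : \sum_A (~~ g A)%:R = c * (1 - m).
  have cE : c = \sum_(A : {set 'I_n}) 1 by rewrite sumr_const.
  rewrite mulrBr mulr1 -gE cE -sumrB.
  by apply: eq_bigr => A _; case: (g A); rewrite ?subrr ?subr0.
have le1 : \sum_A (g A != g (~: A))%:R <= 2 * (c * m).
  rewrite -gE mulr_natl mulr2n -{2}(sum_setC (fun A : {set 'I_n} => (g A)%:R)) -big_split.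
  by apply: ler_sum => A _ /=; rewrite -natrD ler_nat; case: (g A) (g (~: A)) => -[].
have le2 : \sum_A (g A != g (~: A))%:R <= 2 * (c * (1 - m)).
  rewrite -gN mulr_natl mulr2n -{2}(sum_setC (fun A : {set 'I_n} => (~~ g A)%:R)) -big_split.
  by apply: ler_sum => A _ /=; rewrite -natrD ler_nat; case: (g A) (g (~: A)) => -[].
by apply: le_min_variance.
Qed.

(** The function sorted along the complement of [A] is fixed by sorting along [t]. It serves as the
    intermediate point of a triangle inequality, and contraction bounds the second leg by the
    first. *)
Lemma hd_sorts_cat_complement s t A h : {subset t <= subs (~: A) s} ->
  (hd (sorts (subs A s) h) (sorts (subs A s ++ t) h) <=
   2 * hd (sorts (subs A s) h) (sorts (subs (~: A) s) h))%N.
Proof.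
move=> ts; rewrite sorts_cat mul2n -addnn.
apply: leq_trans (hd_triangle (sorts (subs (~: A) s) h) _ _) _.
rewrite leq_add2l [X in (_ <= X)%N]hdC.
rewrite -[X in hd X _](@sorts_id _ _ sg lo t); first exact: hd_sorts.
by move=> i it; apply: sorts_sorted => //; apply: ts.
Qed.

(* A random order: the coordinates surviving the most rounds of random
   deletion come first. *)
Fixpoint survival_order A (bs : seq {set 'I_n}) : seq 'I_n :=
  if bs is B :: bs' then survival_order (A :&: B) bs' ++ enum (A :\: B)
  else enum A.

(** Restricting the initial set only filters the order. With the other rounds fixed, the survivors
    of one round [B] therefore form a random half of a fixed sequence. *)
Lemma survival_orderI A B bs : survival_order (A :&: B) bs = subs B (survival_order A bs).
Proof.
have enumI (C D : {set 'I_n}) : enum (C :&: D) = subs D (enum C).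
  rewrite /enum_mem -filter_predI; apply: eq_filter => j.
  by rewrite /= !inE andbC.
elim: bs A => [|C bs IH] A /=; first exact: enumI.
by rewrite filter_cat setIAC IH -setIDAC enumI.
Qed.

Lemma mem_survival_order A bs : survival_order A bs =i A.
Proof.
elim: bs A => [|B bs IH] A j /=; first by rewrite mem_enum.
by rewrite mem_cat IH mem_enum !inE; case: (j \in A) (j \in B) => -[].
Qed.

Lemma uniq_survival_order A bs : uniq (survival_order A bs).
Proof.
elim: bs A => [|B bs IH] A /=; first exact: enum_uniq.
rewrite cat_uniq IH enum_uniq andbT /=; apply/hasPn => j.
by rewrite mem_enum mem_survival_order !inE => /andP[/negbTE-> _]; rewrite andbF.
Qed.

(** Expectation over [L] independent uniform sets of coordinates. *)
Fixpoint mean_rounds L (F : seq {set 'I_n} -> R) : R :=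
  if L is L'.+1 then (\sum_B mean_rounds L' (fun bs => F (B :: bs))) / c
  else F [::].

Lemma card_set_gt0 : 0 < c.
Proof. by rewrite ltr0n; apply/card_gt0P; exists set0. Qed.

Lemma mean_rounds_le L F G : (forall bs, F bs <= G bs) -> mean_rounds L F <= mean_rounds L G.
Proof.
elim: L F G => [|L IH] F G FG //=.
by rewrite ler_pM2r ?invr_gt0 ?card_set_gt0//; apply: ler_sum => B _; apply: IH.
Qed.

Lemma mean_roundsD L F G :
  mean_rounds L (fun bs => F bs + G bs) = mean_rounds L F + mean_rounds L G.
Proof.
elim: L F G => [|L IH] F G //=; rewrite -mulrDl -big_split /=.
by congr (_ / _); apply: eq_bigr => B _; rewrite IH.
Qed.

Lemma mean_rounds_cst L a : mean_rounds L (fun=> a) = a.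
Proof.
elim: L => //= L ->; rewrite sumr_const -[a *+ _]mulr_natl mulrAC mulfV ?mul1r//.
by rewrite gt_eqF// card_set_gt0.
Qed.

Lemma mean_roundsM L a F : mean_rounds L (fun bs => F bs * a) = mean_rounds L F * a.
Proof.
elim: L F => //= L IH F; rewrite [RHS]mulrAC [in RHS]mulr_suml; congr (_ / _).
by apply: eq_bigr => B _; rewrite IH.
Qed.

Lemma mean_rounds_sum L (I : finType) (F : I -> seq {set 'I_n} -> R) :
  \sum_k mean_rounds L (F k) = mean_rounds L (fun bs => \sum_k F k bs).
Proof.
elim: L F => //= L IH F; rewrite -mulr_suml exchange_big /=; congr (_ / _).
by apply: eq_bigr => B _; rewrite IH.
Qed.

Lemma mean_card_setI A : (\sum_B #|A :&: B|%:R) / c = #|A|%:R / 2 :> R.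
Proof.
have -> : \sum_B #|A :&: B|%:R = \sum_(i in A) \sum_(B : {set 'I_n} | i \in B) 1 :> R.
  rewrite (exchange_big_dep predT) //=; apply: eq_bigr => B _.
  by rewrite -sumr_const; apply: eq_bigl => i; rewrite !inE.
under eq_bigr do rewrite (@sum_mem_half (fun=> 1) _ (fun=> erefl)).1 sumr_const.
rewrite sumr_const -[X in X / _ = _]mulr_natl.
have := card_set_gt0; move: (#|A|%:R : R) => a; move: c => k k0.
by field; rewrite gt_eqF.
Qed.

Section Bound.
Variables (h : fn) (w : 'I_n -> fn).
Hypothesis cov : forall i, covers i h (w i).
Let Psi : R := \sum_x Num.sqrt #|[pred i | w i x]|%:R.

Lemma load_le s x : uniq s -> (load s w x <= #|[pred i | w i x]|)%N.
Proof.
move=> us; rewrite /load -size_filter cardE; apply: uniq_leq_size.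
  exact: filter_uniq.
by move=> i; rewrite mem_filter mem_enum => /andP[].
Qed.

(** For fixed [bs], [survival_order A bs] is a fixed sequence split at random by [B]. The factor 8
    is 2 from [hd_sorts_cat_complement] times 4 from [sum_hd_split]. *)
Lemma round_le A bs :
  (\sum_B (hd (sorts (survival_order (A :&: B) bs) h)
     (sorts (survival_order (A :&: B) bs ++ enum (A :\: B)) h))%:R) / c <= 8 * Psi.
Proof.
rewrite ler_pdivrMr ?card_set_gt0//.
set s := survival_order A bs; have us : uniq s by apply: uniq_survival_order.
have vs : \sum_x mean_srt s h x * (1 - mean_srt s h x) <= Psi.
  apply: le_trans (sum_variance_le R sgK lo_sg us (fun i _ => @cov i)) _.
  by apply: ler_sum => x _; rewrite ler_sqrt ?ler0n// ler_nat load_le.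
apply: le_trans (_ : _ <= 2 * (c * (4 * Psi))) _; last by lra.
apply: le_trans (_ : _ <= 2 * \sum_B (hd (sorts (subs B s) h) (sorts (subs (~: B) s) h))%:R) _.
  rewrite mulr_sumr; apply: ler_sum => B _; rewrite survival_orderI -natrM ler_nat.
  apply: hd_sorts_cat_complement => j.
  by rewrite mem_enum mem_filter mem_survival_order !inE.
rewrite ler_pM2l ?ltr0n//; apply: le_trans (sum_hd_split h us) _.
by rewrite !ler_pM2l ?card_set_gt0 ?ltr0n.
Qed.

(** One round is peeled off: [h] is compared with the function sorted along the survivors
    (induction), and the latter with the function sorted along all of [A] ([round_le]). The expected
    number of survivors halves each time. *)
Lemma mean_hd_survival L A :
  mean_rounds L (fun bs => (hd h (sorts (survival_order A bs) h))%:R) <=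
  #|X|%:R * #|A|%:R / 2 ^+ L + L%:R * (8 * Psi).
Proof.
elim: L A => [|L IH] A /=.
  rewrite expr0 divr1 mul0r addr0 -natrM ler_nat.
  (* With no round left, an empty [A] costs nothing, and a nonempty one at most the number of
     points. *)
  have [->|] := eqVneq A set0; first by rewrite enum_set0 hdxx.
  by rewrite -card_gt0 => A0; apply: leq_trans (max_card _) (leq_pmulr _ A0).
pose F1 B bs : R := (hd h (sorts (survival_order (A :&: B) bs) h))%:R.
pose F2 B bs : R := (hd (sorts (survival_order (A :&: B) bs) h)
     (sorts (survival_order (A :&: B) bs ++ enum (A :\: B)) h))%:R.
apply: le_trans (_ : _ <= (\sum_B mean_rounds L (F1 B)) / c + (\sum_B mean_rounds L (F2 B)) / c) _.
  rewrite -mulrDl ler_pM2r ?invr_gt0 ?card_set_gt0// -big_split.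
  apply: ler_sum => B _ /=; rewrite -mean_roundsD; apply: mean_rounds_le => bs.
  by rewrite -natrD ler_nat hd_triangle.
have -> : L.+1%:R * (8 * Psi) = L%:R * (8 * Psi) + 8 * Psi.
  by rewrite -[L.+1%:R]natr1; ring.
rewrite addrA; apply: lerD.
  apply: le_trans (_ : _ <= (\sum_B (#|X|%:R * #|A :&: B|%:R / 2 ^+ L + L%:R * (8 * Psi))) / c) _.
    by rewrite ler_pM2r ?invr_gt0 ?card_set_gt0//; apply: ler_sum => B _; apply: IH.
  have cn : c != 0 by rewrite gt_eqF ?card_set_gt0.
  have sumA : \sum_B #|A :&: B|%:R = #|A|%:R / 2 * c by rewrite -mean_card_setI mulfVK.
  have pn : 2 ^+ L != 0 :> R by rewrite expf_neq0 ?pnatr_eq0.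
  rewrite big_split /= -mulr_suml -mulr_sumr sumA sumr_const exprS.
  rewrite -[X in (_ + X) / _]mulr_natl; move: c cn (#|X|%:R : R) (#|A|%:R : R) => k k0 N a.
  by rewrite le_eqVlt; apply/orP; left; apply/eqP; field; rewrite pn.
rewrite mean_rounds_sum -mean_roundsM -[leRHS](mean_rounds_cst L).
by apply: mean_rounds_le => bs; apply: round_le.
Qed.

(** The bound holds on average over random orders; passing to the fixed order [enum 'I_n] costs a
    factor 2 by [hd_sorts_order]. *)
Theorem directed_talagrand L :
  (hd h (sorts (enum 'I_n) h))%:R / 2 <=
  #|X|%:R * n%:R / 2 ^+ L + L%:R * (8 * Psi).
Proof.
have := mean_hd_survival L setT; rewrite cardsT card_ord; apply: le_trans.
rewrite -[leLHS](mean_rounds_cst L); apply: mean_rounds_le => bs.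
rewrite ler_pdivrMr ?ltr0n// [leRHS]mulrC -natrM ler_nat.
apply: (hd_sorts_order sgK lo_sg) => i.
by rewrite mem_enum mem_survival_order inE in_setT.
Qed.

End Bound.
End DirectedTalagrand.

(** * Balanced charging of the violated edges *)

Section GoodSubgraph.
Variables (R : rcfType) (T : finType) (n : nat) (sg : T -> T) (lo : pred T).
Hypothesis sgK : involutive sg.
Hypothesis lo_sg : forall a, lo a -> ~~ lo (sg a).
Local Notation X := {ffun 'I_n -> T}.
Local Notation fn := {ffun X -> bool}.
Local Notation flip := (flip sg).
Local Notation violated := (violated sg lo).
Local Notation sorts := (sorts sg lo).
Local Notation covers := (covers sg lo).
Implicit Types (i j : 'I_n) (s t : seq 'I_n) (x y : X) (h u : fn).
Implicit Types w : {ffun 'I_n -> fn}.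

Definition deg w x := #|[pred i | w i x]|.
Definition cost w : R := \sum_x Num.sqrt (deg w x)%:R.

Variable h : fn.

Definition relevant i x := violated i h x || violated i h (flip i x).

Lemma relevant_flip i x : relevant i (flip i x) = relevant i x.
Proof. by rewrite /relevant flipK// orbC. Qed.

Lemma relevant_move i x : relevant i x -> sg (x i) != x i.
Proof.
rewrite /relevant /violated lower_flip => rel; apply/negP => /eqP e.
by move: rel; rewrite /lower /upper e; have := @lo_sg (x i); rewrite e; case: (lo _) => // /(_ isT).
Qed.

(** [w i x] reads: the edge at [x] in direction [i] is charged to [x]. Charging both endpoints is
    allowed; edges that are not violated are never charged. *)
Definition orientation w := [forall i, forall x,
  (violated i h x ==> w i x || w i (flip i x)) && (w i x ==> relevant i x)].

Lemma orientationP w : reflect ((forall i, covers i h (w i)) /\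
  (forall i x, w i x -> relevant i x)) (orientation w).
Proof.
apply: (iffP idP) => [/forallP o|[c r]].
  by split=> i x; have /forallP/(_ x)/andP[/implyP + /implyP] := o i.
by apply/forallP => i; apply/forallP => x; apply/andP; split; apply/implyP; [apply: c|apply: r].
Qed.

(* Reassigning to [y] all its edges paid by neighbours of degree less than [M]
   cannot lower the cost of a minimal orientation. *)
Lemma minimal_orientation_balanced w y M : orientation w ->
  (forall w', orientation w' -> cost w <= cost w') ->
  (#|[pred i | w i (flip i y) && (deg w (flip i y) < M)]| <= 4 * M)%N.
Proof.
move=> /orientationP[cov rel] wmin.
set D := [pred i | _].
have DE i : (i \in D) = w i (flip i y) && (deg w (flip i y) < M)%N by [].
have relD i : i \in D -> relevant i y.
  by rewrite DE => /andP[/rel]; rewrite relevant_flip.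
have moveD i j : i \in D -> (flip i y j == y j) = (j != i).
  move=> iD; rewrite ffunE; have [->|_] := eqVneq j i; last by rewrite eqxx.
  by apply/negbTE/relevant_move/relD.
have flipN i : i \in D -> (flip i y == y) = false.
  move=> iD; apply/negP => /eqP e.
  by have := moveD i i iD; rewrite e !eqxx.
have flip_inj i j : i \in D -> j \in D -> (flip i y == flip j y) = (i == j).
  move=> iD jD; apply/eqP/eqP => [e|->//]; apply/eqP.
  have := moveD i i iD; rewrite eqxx e moveD// => /negbT.
  by rewrite negbK.
pose w' : {ffun 'I_n -> fn} := [ffun i => [ffun x =>
  if i \in D then if x == y then true else if x == flip i y then false else w i x
  else w i x]].
have w'E i x : w' i x = if i \in D then if x == y then true else if x == flip i y then false else w i x
  else w i x by rewrite !ffunE.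
have ow' : orientation w'.
  apply/orientationP; split=> i x; last first.
    rewrite w'E; case: ifP => iD; last exact: rel.
    case: eqP => [->|_]; first by move=> _; apply: relD.
    by case: eqP => // _; apply: rel.
  move=> v; rewrite !w'E; case: ifP => iD; last exact: cov.
  have [//|xy] := eqVneq x y.
  have -> : (flip i x == y) = (x == flip i y) by rewrite (can2_eq (flipK sgK i) (flipK sgK i)).
  have [//|xfy] := eqVneq x (flip i y).
  have -> : (flip i x == flip i y) = (x == y) by rewrite (can_eq (flipK sgK i)).
  by rewrite (negbTE xy); apply: cov.
(* The saving guaranteed by [sqrt_pred_le] at each neighbour that loses a charge. *)
pose q : R := (2 * Num.sqrt M%:R)^-1.
have q0 : 0 <= q by rewrite invr_ge0 mulr_ge0 ?sqrtr_ge0.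
have degy : (deg w' y <= deg w y + #|D|)%N.
  rewrite /deg -cardUI; apply: leq_trans (leq_addr _ _).
  apply: subset_leq_card; apply/subsetP => i wi.
  have : w' i y by []; rewrite w'E eqxx.
  by case: ifP => iD {}wi; apply/orP; [right|left].
have degD i : i \in D -> deg w (flip i y) = (deg w' (flip i y)).+1.
  move=> iD; rewrite /deg (cardD1 i) inE; move: (iD); rewrite DE => /andP[-> _].
  rewrite add1n; congr _.+1; apply: eq_card => j.
  rewrite !inE w'E flipN//; have [->|ji] /= := eqVneq j i; first by rewrite iD eqxx.
  case: ifP => jD //; by rewrite flip_inj// eq_sym (negbTE ji).
have degN x : x != y -> (forall i, i \in D -> x != flip i y) -> deg w' x = deg w x.
  move=> xy xf; apply: eq_card => i; rewrite !inE w'E (negbTE xy).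
  by case: ifP => // iD; rewrite (negbTE (xf i iD)).
(* Pointwise balance: a neighbour in the star of [y] saves at least [q], while [y] itself pays at
   most [sqrt #|D|] more. *)
have pt x : Num.sqrt (deg w' x)%:R + \sum_(i in D) (x == flip i y)%:R * q <=
    Num.sqrt (deg w x)%:R + (x == y)%:R * Num.sqrt #|D|%:R.
  have [->|xy] := eqVneq x y.
    rewrite big1 ?addr0 ?mul1r; last by move=> i iD; rewrite eq_sym flipN// mul0r.
    apply: le_trans (sqrtD_le _ _); rewrite ?ler0n//.
    by rewrite ler_sqrt ?addr_ge0 ?ler0n// -natrD ler_nat.
  rewrite mul0r addr0.
  have [/existsP[i /andP[iD /eqP->]]|] := boolP [exists i, (i \in D) && (x == flip i y)].
    rewrite (bigD1 i)//= eqxx mul1r big1 ?addr0; last first.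
      by move=> j /andP[jD ji]; rewrite flip_inj// eq_sym (negbTE ji) mul0r.
    rewrite degD//; apply: sqrt_pred_le; rewrite -degD//.
    by move: iD; rewrite DE => /andP[_ /ltnW].
  rewrite negb_exists => /forallP xf.
  have xf' i : i \in D -> x != flip i y by move=> iD; have := xf i; rewrite iD.
  by rewrite degN// big1 ?addr0// => i iD; rewrite (negbTE (xf' i iD)) mul0r.
have := ler_sum (index_enum X) (fun x (_ : true) => pt x).
rewrite !big_split /= -/(cost w') -/(cost w) exchange_big /=.
have -> : \sum_x (x == y)%:R * Num.sqrt #|D|%:R = Num.sqrt #|D|%:R :> R.
  rewrite (bigD1 y)//= eqxx mul1r big1 ?addr0// => x /negbTE->; by rewrite mul0r.
have -> : \sum_(i in D) \sum_x (x == flip i y)%:R * q = #|D|%:R * q.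
  rewrite -sum1_card natr_sum mulr_suml; apply: eq_bigr => i _.
  by rewrite (bigD1 (flip i y))//= eqxx mul1r big1 ?addr0 ?mul1r// => x /negbTE->; rewrite mul0r.
have := wmin _ ow'; move: (cost w) (cost w') => c c' cc' le.
(* Minimality means that the total saving does not exceed the extra cost. Hence
   [sqrt #|D| <= 2 sqrt M]. *)
have {c c' cc'}le : #|D|%:R * q <= Num.sqrt #|D|%:R by lra.
have [->//|D0] := posnP #|D|.
have M0 : (0 < M)%N.
  by case/card_gt0P: D0 => i; rewrite DE => /andP[_]; apply: leq_trans.
have s0 : 0 < Num.sqrt M%:R :> R by rewrite sqrtr_gt0 ltr0n.
have t0 : 0 < Num.sqrt #|D|%:R :> R by rewrite sqrtr_gt0 ltr0n.
move: le; rewrite ler_pdivrMr ?mulr_gt0//.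
rewrite -{1}[#|D|%:R](@sqr_sqrtr R) ?ler0n// expr2 ler_pM2l// => le.
have := le; rewrite -ler_sqr ?nnegrE ?mulr_ge0 ?sqrtr_ge0//.
by rewrite exprMn !sqr_sqrtr ?ler0n// -natrX -natrM ler_nat.
Qed.

Lemma exists_minimal_orientation :
  exists2 w, orientation w & forall w', orientation w' -> cost w <= cost w'.
Proof.
(* Charging every violated edge to both endpoints is an orientation. *)
pose w0 : {ffun 'I_n -> fn} := [ffun i => [ffun x => relevant i x]].
have o0 : orientation w0.
  apply/orientationP; split=> i x; rewrite !ffunE// /relevant => ->//.
by have [w ow wmin] := arg_minP cost o0; exists w.
Qed.

End GoodSubgraph.

(** * Dyadic families of stars of violated edges *)

Section StarFamily.
Variables (T : finType) (n : nat) (sg : T -> T).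
Local Notation X := {ffun 'I_n -> T}.
Local Notation fn := {ffun X -> bool}.
Local Notation flip := (flip sg).

(** Stars of violated edges going up from the points of [A], all of degree about [K]. The last field
    bounds how many star edges arrive at one point, so a few bad endpoints cannot spoil most of the
    stars. *)
Record star_family (lo : pred T) (h : fn) (K : nat) (A : {set X})
    (D : X -> {set 'I_n}) : Prop := StarFamily {
  star_violated : forall x i, x \in A -> i \in D x -> violated sg lo i h x;
  star_deg : forall x, x \in A -> (K <= #|D x| < 2 * K)%N;
  star_codeg : forall y,
    (#|[pred i | (flip i y \in A) && (i \in D (flip i y))]| <= 8 * K)%N }.

(** Negating the function and exchanging lower and upper ends preserves violated edges. Stars going
    down become stars going up for this dual. *)
Definition neg_fn (h : fn) : fn := [ffun x => ~~ h x].

Variable lo : pred T.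
Hypothesis sgK : involutive sg.
Hypothesis lo_sg : forall a, lo a -> ~~ lo (sg a).

Lemma dual_lo_sg a : lo (sg a) -> ~~ lo (sg (sg a)).
Proof. by move/lo_sg. Qed.

Lemma violated_dual i h x :
  violated sg (fun a => lo (sg a)) i (neg_fn h) x = violated sg lo i h (flip i x).
Proof.
rewrite /violated lower_flip /upper /lower !ffunE negbK flipK//.
by congr (_ && _); rewrite andbC.
Qed.

Variables (R : rcfType) (h : fn).
Hypothesis n_gt0 : (0 < n)%N.

(** The points are put into [2 (trunc_log 2 n + 1)] buckets, and the bucket contributing most to the
    cost of a minimal orientation is kept. *)
Lemma exists_star_family : exists w K (A : {set X}) (D : X -> {set 'I_n}),
  [/\ orientation sg lo h w, (0 < K <= n)%N,
      cost R w <= (2 * (trunc_log 2 n).+1)%:R * (#|A|%:R * Num.sqrt (2 * K)%:R) &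
      star_family lo h K A D \/ star_family (fun a => lo (sg a)) (neg_fn h) K A D].
Proof.
have [w ow wmin] := exists_minimal_orientation R sg lo h.
have [_ rel] := orientationP _ _ _ _ ow.
pose lv := (trunc_log 2 n).+1.
(* Buckets by the value of [h] and by dyadic degree. The value tells whether a charged point is the
   lower or the upper end of its edges. *)
pose A (bk : bool * 'I_lv) := [set x : X | (h x == bk.1) && (2 ^ bk.2 <= deg w x < 2 ^ bk.2.+1)%N].
have deg_n x : (deg w x <= n)%N by rewrite -[leqRHS]card_ord max_card.
have cost_le : cost R w <= \sum_bk #|A bk|%:R * Num.sqrt (2 * 2 ^ bk.2)%:R.
  under eq_bigr => bk _ do rewrite -sum1_card natr_sum mulr_suml big_mkcond.
  rewrite exchange_big; apply: ler_sum => x _ /=.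
  have [->|d0] := posnP (deg w x).
    by rewrite sqrtr0; apply: sumr_ge0 => bk _; case: ifP => // _; rewrite mul1r sqrtr_ge0.
  have klv : (trunc_log 2 (deg w x) < lv)%N by rewrite ltnS leq_trunc_log.
  rewrite (bigD1 (h x, Ordinal klv))//= inE eqxx trunc_logP// trunc_log_ltn//= mul1r.
  rewrite ler_wpDr//; first by apply: sumr_ge0 => bk _; case: ifP => // _; rewrite mul1r sqrtr_ge0.
  by rewrite ler_sqrt ?ler0n// ler_nat -expnS ltnW// trunc_log_ltn.
have [[b k] le] := exists_ge_mean (true, ord0) cost_le.
rewrite card_prod card_bool card_ord in le.
exists w, (2 ^ k)%N, (A (b, k)), (fun x => [set i | w i x]); split=> //.
  rewrite expn_gt0/= (leq_trans _ (trunc_logP (isT : 1 < 2)%N n_gt0))//.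
  by rewrite leq_exp2l// -ltnS.
have degE x : #|[set i | w i x]| = deg w x by rewrite cardsE.
have degA x : x \in A (b, k) -> (2 ^ k <= #|[set i | w i x]| < 2 * 2 ^ k)%N.
  by rewrite degE inE => /andP[_]; rewrite expnS.
have codeg y : (#|[pred i | (flip i y \in A (b, k)) && (i \in [set j | w j (flip i y)])]| <= 8 * 2 ^ k)%N.
  (* Degrees in the bucket are below [2 ^ k.+1], so the balance property is used with this value of
     [M]. *)
  apply: leq_trans (_ : _ <= 4 * 2 ^ k.+1)%N _; last by rewrite expnS; lia.
  apply: leq_trans (minimal_orientation_balanced sgK lo_sg y _ ow wmin).
  apply: subset_leq_card; apply/subsetP => i; rewrite !inE.
  by case/andP => /andP[_ /andP[_ ->]] ->.
have viol x i : x \in A (b, k) -> i \in [set i | w i x] ->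
    if b then violated sg lo i h x else violated sg lo i h (flip i x).
  rewrite !inE /= => /andP[/eqP <- _] /rel /orP.
  by rewrite /violated flipK//; case: (h x) => -[] // /and3P[].
case: b viol {le} codeg degA => viol codeg degA; [left|right].
  by split=> [x i xA iD|x xA|y]; [apply: viol|apply: degA|apply: codeg].
split=> [x i xA iD|x xA|y]; [|exact: degA|exact: codeg].
by rewrite violated_dual; apply: viol.
Qed.

End StarFamily.

(** * Random walks *)

Section Walk.
Variables (R : rcfType) (T : finType) (n : nat) (sg : T -> T) (lo : pred T).
Hypothesis sgK : involutive sg.
Hypothesis lo_sg : forall a, lo a -> ~~ lo (sg a).
Local Notation X := {ffun 'I_n -> T}.
Local Notation fn := {ffun X -> bool}.
Local Notation flip := (flip sg).
Local Notation lower := (lower lo).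
Local Notation upper := (upper sg lo).
Local Notation violated := (violated sg lo).
Implicit Types (i j : 'I_n) (s t : seq 'I_n) (x y : X) (F G : X -> R).

Definition up i x : X := if lower i x then flip i x else x.

Lemma lower_up i j x : i != j -> lower i (up j x) = lower i x.
Proof. by move=> ij; rewrite /up; case: ifP => // _; rewrite lower_flipN. Qed.

Lemma up_flip i j x : i != j -> up j (flip i x) = flip i (up j x).
Proof.
move=> ij; rewrite /up lower_flipN 1?eq_sym//; case: ifP => // _.
exact: flipC.
Qed.

Lemma up_flip_lower i x : lower i x -> up i (flip i x) = flip i x.
Proof. by move=> l; rewrite /up lower_flip lower_upperF. Qed.

Variable p : R.

(* [walk s F x] is the expectation of [F] after each coordinate of [s] has been
   moved up, independently with probability [p], starting from [x]. *)
Fixpoint walk s F x : R :=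
  if s is i :: s' then (1 - p) * walk s' F x + p * walk s' F (up i x) else F x.

Lemma walk_cst s (a : R) x : walk s (fun=> a) x = a.
Proof. by elim: s x => //= i s IH x; rewrite !IH; ring. Qed.

Lemma walkD s F G x : walk s (fun z => F z + G z) x = walk s F x + walk s G x.
Proof. by elim: s x => //= i s IH x; rewrite !IH; ring. Qed.

Lemma eq_walk s F G x : F =1 G -> walk s F x = walk s G x.
Proof. by move=> FG; elim: s x => //= i s IH x; rewrite !IH. Qed.

Hypotheses (p_ge0 : 0 <= p) (p_le1 : p <= 1).

Lemma walk_le s F G x : (forall z, F z <= G z) -> walk s F x <= walk s G x.
Proof.
move=> FG; elim: s x => //= i s IH x.
by rewrite lerD// ler_wpM2l ?subr_ge0.
Qed.

Lemma walk_ge0 s F x : (forall z, 0 <= F z) -> 0 <= walk s F x.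
Proof. by move=> F0; rewrite -(walk_cst s 0 x); apply: walk_le. Qed.

Lemma walk_le1 s F x : (forall z, F z <= 1) -> walk s F x <= 1.
Proof. by move=> F1; rewrite -(walk_cst s 1 x); apply: walk_le. Qed.

(** Given that [i] moves, the walk from [x] behaves like the walk from [flip i x]. The left side is
    thus the expectation of [F] times the number of moved coordinates of [D], and the square
    accounts for two or more of them moving. *)
Lemma walk_star s F (D : {set 'I_n}) x : uniq s -> (forall z, 0 <= F z <= 1) ->
  (forall i, i \in s -> i \in D -> lower i x) ->
  p * (\sum_(i <- s | i \in D) walk s F (flip i x)) <=
  walk s F x + (p * (count [in D] s)%:R) ^+ 2.
Proof.
move=> us F01.
have F0 z : 0 <= F z by case/andP: (F01 z).
have F1 z : F z <= 1 by case/andP: (F01 z).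
elim: s us x => [|j s IH] /= us x low.
  by rewrite big_nil mulr0 addr_ge0 ?sqr_ge0.
case/andP: us => js us.
have ne i : i \in s -> i != j by move=> is_; apply: contraNneq js => <-.
have step y : \sum_(i <- s | i \in D) ((1 - p) * walk s F (flip i y) + p * walk s F (up j (flip i y)))
  = (1 - p) * (\sum_(i <- s | i \in D) walk s F (flip i y)) +
    p * (\sum_(i <- s | i \in D) walk s F (flip i (up j y))).
  rewrite big_split /= -!mulr_sumr; congr (_ + _ * _).
  rewrite big_seq_cond [RHS]big_seq_cond; apply: eq_bigr => i /andP[/ne ij _].
  by rewrite up_flip.
have low' i : i \in s -> i \in D -> lower i x by move=> is_; apply: low; rewrite in_cons is_ orbT.
have lowu i : i \in s -> i \in D -> lower i (up j x).
  by move=> is_ iD; rewrite lower_up ?ne// low'.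
have IH1 := IH us x low'; have IH2 := IH us (up j x) lowu.
rewrite big_cons step; case: ifP => jD.
  have lj : lower j x by apply: low; rewrite ?mem_head.
  rewrite (up_flip_lower lj) {1 2}/up lj.
  set A := walk s F (flip j x); set k : R := (count _ s)%:R in IH1 *.
  set S1 := \sum_(i <- s | _) _ in IH1 *; set S2 := \sum_(i <- s | _) _.
  have S2k : S2 <= k.
    rewrite /S2 /k -sum1_count natr_sum; apply: ler_sum => i _; exact: walk_le1.
  have -> : (true + count [in D] s)%:R = 1 + k :> R by rewrite natrD.
  have k0 : 0 <= k by rewrite ler0n.
  have pk : 0 <= (1 - p) * (walk s F x + (p * k) ^+ 2 - p * S1).
    by rewrite mulr_ge0 ?subr_ge0.
  have ps : 0 <= p ^+ 2 * (k - S2) by rewrite mulr_ge0 ?sqr_ge0 ?subr_ge0.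
  have pk2 : 0 <= p * (p * k) ^+ 2 by rewrite mulr_ge0 ?sqr_ge0.
  have pk3 : 0 <= p ^+ 2 * k by rewrite mulr_ge0 ?sqr_ge0.
  have := sqr_ge0 p; nra.
rewrite add0n; set k : R := _%:R in IH1 IH2 *.
have q1 : 0 <= 1 - p by rewrite subr_ge0.
have := lerD (ler_wpM2l q1 IH1) (ler_wpM2l p_ge0 IH2); lra.
Qed.

Section Sensitivity.
Variable f : fn.

Definition drift s y : R := walk s (fun z => (f z != f y)%:R) y.
Definition sens j y : R := (lower j y && (f (flip j y) != f y))%:R.

Lemma drift_ge0 s y : 0 <= drift s y.
Proof. by apply: walk_ge0 => z; rewrite ler0n. Qed.

(** If [j] moves, the rest of the walk is compared with its own starting value, and the change of
    [f] across the edge in direction [j] is added. *)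
Lemma drift_cons j s y :
  drift (j :: s) y <= (1 - p) * drift s y + p * drift s (up j y) + p * sens j y.
Proof.
rewrite /drift /= -addrA lerD2l -mulrDr ler_wpM2l//.
rewrite -(walk_cst s (sens j y) (up j y)) -walkD; apply: walk_le => z.
rewrite -natrD ler_nat /up; case: (lower j y) => /=; last by rewrite addn0.
by case: (f z); case: (f y); case: (f (flip j y)).
Qed.

(** One factor of the density, relative to the uniform measure, of a uniform point after each
    coordinate of [t] has moved up with probability [p]: lower points lose a fraction [p] of their
    mass to their upper partners. *)
Definition ratio j x : R := if lower j x then 1 - p else if upper j x then 1 + p else 1.
Definition density t x : R := \prod_(j <- t) ratio j x.

Lemma ratio_ge0 j x : 0 <= ratio j x.
Proof.
rewrite /ratio; case: ifP => _; first by rewrite subr_ge0.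
by case: ifP => _ //; rewrite addr_ge0.
Qed.

Lemma density_ge0 t x : 0 <= density t x.
Proof. by apply: prodr_ge0 => j _; apply: ratio_ge0. Qed.

Lemma density_flip j t x : j \notin t -> density t (flip j x) = density t x.
Proof.
move=> jt; rewrite /density big_seq [RHS]big_seq; apply: eq_bigr => k kt.
have kj : k != j by apply: contraNneq jt => <-.
by rewrite /ratio lower_flipN// upper_flipN.
Qed.

Lemma sum_flip_eq i F G : (forall x, F x + F (flip i x) = G x + G (flip i x)) ->
  \sum_x F x = \sum_x G x.
Proof.
move=> e; apply/eqP; rewrite eq_le; apply/andP; split;
by apply: (sum_flip_le sgK (i := i)) => x; rewrite e.
Qed.

Lemma sum_density_step j t G : j \notin t ->
  \sum_x density t x * ((1 - p) * G x + p * G (up j x)) = \sum_x density (j :: t) x * G x.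
Proof.
move=> jt; apply: (sum_flip_eq (i := j)) => x.
rewrite density_flip// /density !big_cons -/(density t x) -/(density t (flip j x)) density_flip//.
rewrite /up /ratio flipK//.
by case: (positionP sgK lo_sg j x) => [_|_|]; ring.
Qed.

(** The coordinates of [t] have already moved and sit in the density; those of [s] are still to
    move. Transferring one coordinate from [s] to [t] costs [p] times its sensitivity under the
    current density. *)
Lemma sum_density_drift (B : 'I_n -> R) s t :
  (forall j t, uniq t -> \sum_x density t x * sens j x <= B j) ->
  uniq (s ++ t) -> \sum_x density t x * drift s x <= p * \sum_(j <- s) B j.
Proof.
move=> HB; elim: s t => [|j s IH] t /=.
  move=> _; rewrite big_nil mulr0 big1// => x _.
  by rewrite /drift /= eqxx mulr0.
rewrite mem_cat negb_or => /andP[/andP[js jt] ust].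
have ujt : uniq (s ++ j :: t).
  by rewrite (perm_uniq (_ : perm_eq _ (j :: s ++ t))) /= ?mem_cat ?negb_or ?js ?jt// perm_catC /= perm_cons perm_catC.
have ut : uniq t by move: ust; rewrite cat_uniq => /and3P[].
rewrite big_cons mulrDr.
apply: le_trans (_ : _ <= \sum_x density t x * ((1 - p) * drift s x + p * drift s (up j x))
   + p * \sum_x density t x * sens j x) _.
  rewrite mulr_sumr -big_split; apply: ler_sum => x _ /=.
  apply: le_trans (ler_wpM2l (density_ge0 t x) (drift_cons j s x)) _.
  by rewrite mulrDr mulrCA.
by rewrite sum_density_step// [leRHS]addrC lerD ?IH// ler_wpM2l ?HB.
Qed.

(** The density is a product, and on each matched pair the first-order terms of [(1 - p)^q] and
    [(1 + p)^q] cancel. *)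
Lemma sum_density_exp t (q : nat) : uniq t -> q%:R * p <= 1 ->
  \sum_x density t x ^+ q <= #|X|%:R * (1 + (q%:R * p) ^+ 2) ^+ size t.
Proof.
move=> + qp; elim: t => [|j t IH] /=.
  move=> _; rewrite expr0 mulr1.
  under eq_bigr do rewrite /density big_nil expr1n.
  by rewrite sumr_const.
case/andP=> jt ut; rewrite exprS mulrCA.
apply: le_trans (_ : _ <= \sum_x (1 + (q%:R * p) ^+ 2) * density t x ^+ q) _; last first.
  by rewrite -mulr_sumr ler_wpM2l ?IH// addr_ge0 ?sqr_ge0.
apply: (sum_flip_le sgK (i := j)) => x.
rewrite /density !big_cons -/(density t x) -/(density t (flip j x)) density_flip//.
have D0 : 0 <= density t x ^+ q by rewrite exprn_ge0 ?density_ge0.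
rewrite (exprMn _ (ratio j x)) (exprMn _ (ratio j (flip j x))) -mulrDl -mulrDl ler_wpM2r//.
have := exp1D_le p_ge0 qp; have := exp1B_le p_ge0 p_le1 qp; have := sqr_ge0 (q%:R * p).
rewrite /ratio; by case: (positionP sgK lo_sg j x) => [_|_|]; rewrite ?expr1n; lra.
Qed.

(** Where the density is at most 2, it is replaced by 2. Elsewhere it is at most its power [k + 1]
    divided by [2^k], which the moment bound controls. *)
Lemma sum_density_sens j t (k : nat) : uniq t ->
  n%:R * (k.+1%:R * p) ^+ 2 <= 1 / 2 -> k.+1%:R * p <= 1 ->
  \sum_x density t x * sens j x <= 2 * (\sum_x sens j x) + 2 * #|X|%:R / 2 ^+ k.
Proof.
move=> ut nkp kp.
have sizet : (size t <= n)%N by rewrite -(card_uniqP ut) -[leqRHS]card_ord max_card.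
have moment : \sum_x density t x ^+ k.+1 <= 2 * #|X|%:R.
  apply: le_trans (sum_density_exp ut kp) _.
  rewrite mulrC ler_wpM2r ?ler0n// exp1D_le2 ?sqr_ge0//.
  by apply: le_trans nkp; rewrite ler_wpM2r ?sqr_ge0// ler_nat.
apply: le_trans (_ : _ <= \sum_x (2 * sens j x + density t x ^+ k.+1 / 2 ^+ k)) _; last first.
  rewrite big_split /= -mulr_sumr lerD2l -mulr_suml ler_wpM2r// invr_ge0 exprn_ge0//.
apply: ler_sum => x _; have d0 := density_ge0 t x.
have e0 : 0 <= density t x ^+ k.+1 / 2 ^+ k by rewrite divr_ge0 ?exprn_ge0.
rewrite {1 2}/sens; case: (_ && _) => /=; last by rewrite !mulr0 add0r.
rewrite !mulr1; have [d2|d2] := lerP (density t x) 2; first by rewrite ler_wpDr.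
rewrite ler_wpDl// exprS -mulrA -expr_div_n ler_peMr// exprn_ege1//.
by rewrite ler_pdivlMr// mul1r ltW.
Qed.

Lemma sum_drift_le (k : nat) : (n <= 2 ^ k)%N ->
  n%:R * (k.+1%:R * p) ^+ 2 <= 1 / 2 -> k.+1%:R * p <= 1 ->
  \sum_x drift (enum 'I_n) x <=
  p * (2 * (\sum_j \sum_x sens j x) + 2 * #|X|%:R).
Proof.
move=> nk nkp kp.
have := @sum_density_drift (fun j => 2 * (\sum_x sens j x) + 2 * #|X|%:R / 2 ^+ k) (enum 'I_n) [::].
under eq_bigr => x _ do rewrite /density big_nil mul1r.
rewrite cats0 enum_uniq => le; apply: le_trans (le _ isT) _.
  by move=> j t ut; apply: sum_density_sens.
rewrite ler_wpM2l// big_enum big_split /= -mulr_sumr lerD2l sumr_const card_ord -[_ *+ n]mulr_natl.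
(* The tail terms of all [n] directions add up to at most [2 #|X|], because [n <= 2^k]. *)
have -> : n%:R * (2 * #|X|%:R / 2 ^+ k) = 2 * #|X|%:R * (n%:R / 2 ^+ k) :> R by ring.
rewrite ler_piMr ?mulr_ge0//.
by rewrite ler_pdivrMr ?exprn_gt0// mul1r -natrX ler_nat.
Qed.

End Sensitivity.
End Walk.

(** * Rejection probability of a walk *)

Section WalkRejects.
Variables (R : rcfType) (T : finType) (n : nat) (sg : T -> T) (lo : pred T).
Hypothesis sgK : involutive sg.
Hypothesis lo_sg : forall a, lo a -> ~~ lo (sg a).
Local Notation X := {ffun 'I_n -> T}.
Local Notation fn := {ffun X -> bool}.
Local Notation flip := (flip sg).
Local Notation lower := (lower lo).
Local Notation upper := (upper sg lo).
Local Notation violated := (violated sg lo).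
Local Notation sens := (sens R sg lo).
Local Notation drift := (drift sg lo).
Local Notation walk := (walk sg lo).
Implicit Types (i j : 'I_n) (x y : X).
Variable f : fn.
Hypothesis n_gt0 : (0 < n)%N.

Definition nviolated : nat := \sum_i \sum_x violated i f x.

Definition height x : R := \sum_j ((upper j x)%:R - (lower j x)%:R).

(** The summands of [height] are orthogonal: flipping [j] negates the term of [j] and fixes the
    others. *)
Lemma sum_height_sqr : \sum_x height x ^+ 2 <= n%:R * #|X|%:R.
Proof.
pose s j x : R := (upper j x)%:R - (lower j x)%:R.
have s_flip j x : s j (flip j x) = - s j x by rewrite /s upper_flip// lower_flip opprB.
have s_flipN j k x : j != k -> s j (flip k x) = s j x.
  by move=> jk; rewrite /s upper_flipN// lower_flipN.
under eq_bigr => x _ do rewrite expr2 /height mulr_suml.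
have -> : n%:R * #|X|%:R = \sum_(j < n) #|X|%:R :> R.
  by rewrite sumr_const card_ord mulr_natl.
rewrite exchange_big /=.
apply: ler_sum => j _; under eq_bigr => x _ do rewrite mulr_sumr.
rewrite exchange_big /= (bigD1 j)//= [X in _ + X]big1 ?addr0.
  have -> : #|X|%:R = \sum_(x : X) 1 :> R by rewrite sumr_const.
  apply: ler_sum => x _.
  by rewrite -/(s j x) /s; case: (upper j x) (lower j x) => -[]; rewrite /=; lra.
move=> k kj; transitivity (\sum_(x : X) (0 : R)); last by rewrite big1.
apply: (sum_flip_eq sgK (i := j)) => x.
by rewrite -!/(s _ _) s_flip s_flipN//; ring.
Qed.

(** On an edge, the change of [f] is its increase plus twice the violation. The increases sum to the
    correlation of [f] with [height], which is at most [sqrt n] on average. *)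
Lemma sum_sens_le :
  \sum_j \sum_x sens f j x <= Num.sqrt n%:R * #|X|%:R + 2 * nviolated%:R.
Proof.
have r0 : 0 < Num.sqrt n%:R :> R by rewrite sqrtr_gt0 ltr0n.
have step j : \sum_x sens f j x =
  \sum_x (f x)%:R * ((upper j x)%:R - (lower j x)%:R) + 2 * (\sum_x violated j f x)%N%:R.
  rewrite natr_sum mulr_sumr -big_split; apply: (sum_flip_eq sgK (i := j)) => x /=.
  rewrite /sens /violated !flipK// upper_flip// lower_flip.
  case: (positionP sgK lo_sg j x) => [_|_|] /=;
  by case: (f x); case: (f (flip j x)) => /=; lra.
under eq_bigr do rewrite step.
rewrite big_split /= -mulr_sumr -natr_sum lerD2r exchange_big /=.
under eq_bigr do rewrite -mulr_sumr -/(height _).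
(* Arithmetic-geometric mean, in place of Cauchy-Schwarz: [2 a <= a^2 / r + r] with [r = sqrt n]. *)
apply: le_trans (_ : _ <= \sum_x (height x ^+ 2 / Num.sqrt n%:R + Num.sqrt n%:R) / 2) _.
  apply: ler_sum => x _; set r := Num.sqrt _ in r0 *; set a := height x.
  have ra : 2 * a <= a ^+ 2 / r + r.
    have e : (a ^+ 2 / r + r) * r = a ^+ 2 + r ^+ 2 by field; rewrite gt_eqF.
    rewrite -(ler_pM2r r0) e.
    by have := sqr_ge0 (a - r); lra.
  have ra0 : 0 <= a ^+ 2 / r + r by rewrite addr_ge0 ?divr_ge0 ?sqr_ge0 ?ltW.
  by case: (f x); rewrite ?mul1r ?mul0r; lra.
rewrite -mulr_suml big_split /= -mulr_suml sumr_const -[_ *+ #|_|]mulr_natl.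
have : (\sum_x height x ^+ 2) / Num.sqrt n%:R <= Num.sqrt n%:R * #|X|%:R.
  rewrite ler_pdivrMr// mulrAC -expr2 sqr_sqrtr ?ler0n//.
  exact: sum_height_sqr.
lra.
Qed.

Variables (K : nat) (A : {set X}) (D : X -> {set 'I_n}).
Hypothesis star : star_family sg lo f K A D.

Lemma sum_star_drift (V : X -> R) : (forall y, 0 <= V y) ->
  \sum_(x in A) \sum_(i in D x) V (flip i x) <= (8 * K)%:R * \sum_y V y.
Proof.
move=> V0.
have -> : \sum_(x in A) \sum_(i in D x) V (flip i x) =
    \sum_i \sum_x ((x \in A) && (i \in D x))%:R * V (flip i x).
  rewrite exchange_big [RHS](bigID [in A]) /= [X in _ = _ + X]big1 ?addr0; last first.
    by move=> x /negbTE->; apply: big1 => i _; rewrite mul0r.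
  apply: eq_bigr => x ->; rewrite [RHS](bigID [in D x]) /= [X in _ = _ + X]big1 ?addr0.
    by apply: eq_bigr => i ->; rewrite mul1r.
  by move=> i /negbTE->; rewrite mul0r.
under eq_bigr => i _ do rewrite -(sum_flip sgK i).
rewrite exchange_big mulr_sumr; apply: ler_sum => y _ /=.
under eq_bigr do rewrite flipK//.
rewrite -mulr_suml ler_wpM2r// -natr_sum ler_nat.
apply: leq_trans (star_codeg star y).
by rewrite -sum1_card [leqRHS]big_mkcond.
Qed.

Variables (p : R) (k : nat).
Hypothesis p_ge0 : 0 <= p.
Hypothesis nk : (n <= 2 ^ k)%N.
Hypothesis few_violated : nviolated%:R <= Num.sqrt n%:R * #|X|%:R :> R.
Hypothesis p_deg : p * (8 * K)%:R <= 1.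
Hypothesis p_size : p * (256 * k.+1%:R * Num.sqrt n%:R * #|X|%:R) <= #|A|%:R.
Hypothesis K_gt0 : (0 < K)%N.

Definition walk_rejection : R :=
  \sum_x (f x)%:R * walk p (enum 'I_n) (fun z => (~~ f z)%:R) x.

(** A walk from a point of [A] crosses one of its at least [K] star edges with probability about
    [p K], and then ends at value 0 unless [f] changes afterwards. The codegree bound limits the
    total loss from such changes. *)
Lemma walk_rejection_ge : p * K%:R * #|A|%:R / 2 <= walk_rejection.
Proof.
have p_le1 : p <= 1.
  by apply: le_trans p_deg; rewrite ler_peMr// ler1n; lia.
have walk0 x : 0 <= walk p (enum 'I_n) (fun z => (~~ f z)%:R) x.
  by apply: walk_ge0 => // z; rewrite ler0n.
have [->|A0] := eqVneq A set0.
  rewrite cards0 mulr0 mul0r; apply: sumr_ge0 => x _.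
  by rewrite mulr_ge0 ?ler0n.
have X0 : 0 < #|X|%:R :> R.
  by rewrite ltr0n; case/set0Pn: A0 => x _; apply/card_gt0P; exists x.
have AX : #|A|%:R <= #|X|%:R :> R by rewrite ler_nat max_card.
have r1 : 1 <= Num.sqrt n%:R :> R by rewrite -[leLHS]sqrtr1 ler_sqrt ?ler0n// ler1n.
have kr : k.+1%:R * p * Num.sqrt n%:R <= 1 / 256.
  rewrite -(ler_pM2r X0); move: p_size AX; lra.
have k0 : 0 <= k.+1%:R * p by rewrite mulr_ge0.
have kp : k.+1%:R * p <= 1.
  apply: le_trans (_ : _ <= k.+1%:R * p * Num.sqrt n%:R) _; last by lra.
  by rewrite ler_peMr.
have nkp : n%:R * (k.+1%:R * p) ^+ 2 <= 1 / 2.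
  rewrite -[n%:R](@sqr_sqrtr R) ?ler0n// -exprMn mulrC.
  set a := _ * Num.sqrt _ in kr *.
  have a0 : 0 <= a by rewrite mulr_ge0// sqrtr_ge0.
  nra.
pose V := drift p f (enum 'I_n); pose SV := \sum_y V y.
have V0 y : 0 <= V y by apply: drift_ge0.
(* The total sensitivity is at most [3 sqrt n #|X|], which gives the factor 8 below; [p_size] turns
   8/256 into 1/32. *)
have SV_le : SV <= #|A|%:R / 32.
  apply: le_trans (sum_drift_le sgK lo_sg p_ge0 p_le1 f nk nkp kp) _.
  apply: le_trans (_ : _ <= p * (8 * (Num.sqrt n%:R * #|X|%:R))) _.
    rewrite ler_wpM2l//; have := sum_sens_le; move: few_violated.
    have : #|X|%:R <= Num.sqrt n%:R * #|X|%:R :> R by rewrite ler_peMl// ltW.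
    lra.
  have : p * (Num.sqrt n%:R * #|X|%:R) <= p * (Num.sqrt n%:R * #|X|%:R) * k.+1%:R.
    by rewrite ler_peMr ?ler1n// mulr_ge0// mulr_ge0 ?sqrtr_ge0// ltW.
  move: p_size; lra.
(* The quadratic error of [walk_star] takes at most a quarter of the main term since
   [p #|D x| <= 1/4]. Drift takes at most another quarter in total, leaving the half claimed. *)
have pt x : x \in A -> p * (3 / 4 * #|D x|%:R) - p * \sum_(i in D x) V (flip i x) <=
    (f x)%:R * walk p (enum 'I_n) (fun z => (~~ f z)%:R) x.
  move=> xA; have viol i : i \in D x -> violated i f x by apply: (star_violated star).
  have /andP[KD D2K] := star_deg star xA.
  have fx : f x.
    have /card_gt0P[i /viol] : (0 < #|D x|)%N by apply: leq_trans KD.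
    by case/and3P.
  rewrite fx mul1r.
  have F01 z : 0 <= ((~~ f z)%:R : R) <= 1 by rewrite ler0n lern1 leq_b1.
  have low i : i \in enum 'I_n -> i \in D x -> lower i x by move=> _ /viol /and3P[].
  have star_le := walk_star (sg := sg) lo_sg p_ge0 p_le1 (enum_uniq _) F01 low.
  have cD : count [in D x] (enum 'I_n) = #|D x|.
    by rewrite -sum1_count -sum1_card big_enum_cond.
  rewrite cD big_enum_cond /= in star_le.
  have wE i : i \in D x -> walk p (enum 'I_n) (fun z => (~~ f z)%:R) (flip i x) = 1 - V (flip i x).
    move=> /viol /and3P[_ _ /negbTE ff]; rewrite /V /drift ff.
    apply/eqP; rewrite eq_sym subr_eq -walkD -[X in X == _](walk_cst sg lo p (enum 'I_n) 1 (flip i x)).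
    by apply/eqP/eq_walk => z; case: (f z); rewrite ?add0r ?addr0.
  rewrite (eq_bigr _ wE) sumrB sumr_const in star_le.
  have pD : p * #|D x|%:R <= 1 / 4.
    have : #|D x|%:R <= 2 * K%:R :> R by rewrite -natrM ler_nat ltnW.
    move: p_deg; rewrite natrM => pd Dl.
    have := ler_wpM2l p_ge0 Dl; lra.
  have pD0 : 0 <= p * #|D x|%:R by rewrite mulr_ge0.
  have : (p * #|D x|%:R) ^+ 2 <= p * #|D x|%:R / 4.
    by rewrite expr2 [leRHS]mulrC ler_wpM2r//; lra.
  lra.
apply: le_trans (_ : _ <= \sum_(x in A) (f x)%:R * walk p (enum 'I_n) (fun z => (~~ f z)%:R) x) _; last first.
  rewrite /walk_rejection [leRHS](bigID [in A]) /= lerDl; apply: sumr_ge0 => x _.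
  by rewrite mulr_ge0 ?ler0n.
apply: le_trans (ler_sum _ pt); rewrite sumrB -!mulr_sumr.
have sD : K%:R * #|A|%:R <= \sum_(x in A) #|D x|%:R :> R.
  rewrite mulrC mulr_natl -sumr_const; apply: ler_sum => x xA.
  by have /andP[] := star_deg star xA; rewrite ler_nat.
have sV := sum_star_drift V0; rewrite -/SV in sV.
have : (8 * K)%:R * SV <= (8 * K)%:R * (#|A|%:R / 32) by rewrite ler_wpM2l.
rewrite natrM => sV2.
have := ler_wpM2l p_ge0 sD; have := ler_wpM2l p_ge0 sV; have := ler_wpM2l p_ge0 sV2.
rewrite natrM; lra.
Qed.

End WalkRejects.

(** * A sorting network for the grid *)

Section SortingNetwork.
Variables (m n : nat).
Local Notation X := {ffun 'I_n -> 'I_m}.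
Local Notation fn := {ffun X -> bool}.
Implicit Types (a b c : 'I_m) (i k : 'I_n) (x y : X) (h : fn) (e : nat * nat).

Definition siblings j (a b : nat) := (a %/ 2 ^ j.+1 == b %/ 2 ^ j.+1)%N && (a %/ 2 ^ j != b %/ 2 ^ j)%N.

Lemma siblingsC j a b : siblings j a b = siblings j b a.
Proof. by rewrite /siblings eq_sym [X in _ && ~~ X]eq_sym. Qed.

(* The layer [(j, s)] matches [a] with [s - a] when both lie in the same block of
   length [2 ^ j.+1], but in different halves of it. *)
Definition partner e a : 'I_m :=
  if (a <= e.2)%N && siblings e.1 a (e.2 - a) then insubd a (e.2 - a)%N else a.

Definition partner_lo e a := (a < partner e a)%N.

Variant partner_spec e a : 'I_m -> Prop :=
| PartnerMatched b of (a + b = e.2)%N & siblings e.1 a b : partner_spec e a b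
| PartnerAlone of (forall b, (a + b = e.2)%N -> ~~ siblings e.1 a b) : partner_spec e a a.

Lemma partnerP e a : partner_spec e a (partner e a).
Proof.
rewrite /partner; case: ifP => [/andP[ae sib]|no]; last first.
  apply: PartnerAlone => b ab; move: no; rewrite -ab leq_addr addKn /=.
  by move=> /negbT.
rewrite /insubd; case: insubP => [b _ bE|lt]; first by apply: PartnerMatched; rewrite bE// subnKC.
apply: PartnerAlone => b ab; apply: contra lt => _.
by rewrite -ab addKn.
Qed.

Lemma partnerK e : involutive (partner e).
Proof.
move=> a; have [b ab sib|no] := partnerP e a.
  have [c bc _|/(_ a)] := partnerP e b; first by apply/val_inj => /=; lia.
  by rewrite addnC ab siblingsC sib => /(_ erefl).
by case: (partnerP e a) => // b ab; rewrite (negbTE (no b ab)).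
Qed.

Lemma partner_loN e a : partner_lo e a -> ~~ partner_lo e (partner e a).
Proof. by rewrite /partner_lo partnerK -leqNgt => /ltnW. Qed.

Definition upd i b x : X := [ffun k => if k == i then b else x k].

Definition le_at i h a b := forall x, h (upd i a x) -> h (upd i b x).

Lemma le_at_other e i k h a b : k != i -> le_at i h a b ->
  le_at i (srt (partner e) (partner_lo e) k h) a b.
Proof.
move=> ki le x; rewrite !ffunE.
have lowE c : lower (partner_lo e) k (upd i c x) = lower (partner_lo e) k x.
  by rewrite /lower ffunE (negbTE ki).
have uppE c : upper (partner e) (partner_lo e) k (upd i c x) = upper (partner e) (partner_lo e) k x.
  by rewrite /upper ffunE (negbTE ki).
have flipE c : flip (partner e) k (upd i c x) = upd i c (flip (partner e) k x).
  by apply/ffunP => l; rewrite !ffunE; case: eqP => [->|//]; rewrite (negbTE ki).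
rewrite !lowE !uppE !flipE.
case: ifP => _; first by case/andP => /le -> /le ->.
case: ifP => _; last exact: le.
by case/orP => /le ->; rewrite ?orbT.
Qed.

Lemma srt_upd e i h a x :
  srt (partner e) (partner_lo e) i h (upd i a x) =
  if (a < partner e a)%N then h (upd i a x) && h (upd i (partner e a) x)
  else h (upd i a x) || h (upd i (partner e a) x).
Proof.
rewrite ffunE.
have -> : flip (partner e) i (upd i a x) = upd i (partner e a) x.
  by apply/ffunP => l; rewrite !ffunE; case: eqP.
rewrite /lower /upper /partner_lo !ffunE eqxx partnerK.
case: ltngtP => // /val_inj <-; by rewrite orbb.
Qed.

Lemma le_at_matched e i h a : (a < partner e a)%N ->
  le_at i (srt (partner e) (partner_lo e) i h) a (partner e a).
Proof.
by move=> lt x; rewrite !srt_upd lt partnerK ltnNge (ltnW lt) /= => /andP[-> _]; rewrite orbT.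
Qed.

(** Here sorting can only lower the value at [a] and raise the value at [b]. *)
Lemma le_at_outward e i h a b : le_at i h a b ->
  (a <= partner e a)%N -> (partner e b <= b)%N ->
  le_at i (srt (partner e) (partner_lo e) i h) a b.
Proof.
move=> le ale ble x; rewrite !srt_upd [(b < _)%N]ltnNge ble /=.
move: ale; rewrite leq_eqVlt => /orP[/eqP/val_inj <-|->].
  by rewrite ltnn orbb => /le ->.
by case/andP => /le ->.
Qed.

Lemma le_at_blocks e i h a b :
  le_at i h a b -> le_at i h a (partner e b) ->
  le_at i h (partner e a) b -> le_at i h (partner e a) (partner e b) ->
  le_at i (srt (partner e) (partner_lo e) i h) a b.
Proof.
move=> h1 h2 h3 h4 x; rewrite !srt_upd.
have {}h1 := h1 x; have {}h2 := h2 x; have {}h3 := h3 x; have {}h4 := h4 x.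
case: ifP => _; case: ifP => _; move: h1 h2 h3 h4;
by case: (h (upd i a x)); case: (h (upd i b x)); case: (h (upd i (partner e a) x));
  case: (h (upd i (partner e b) x)) => //= H1 H2 H3 H4; rewrite ?H1 ?H2 ?H3 ?H4.
Qed.

(** The order relations guaranteed before layer [e = (j, s)]: between different blocks of length
    [2 ^ j.+1], and between the two halves of one block for pairs with sum below [s]. *)
Definition known e (a b : nat) :=
  (a %/ 2 ^ e.1.+1 < b %/ 2 ^ e.1.+1)%N ||
  [&& a %/ 2 ^ e.1.+1 == b %/ 2 ^ e.1.+1, a %/ 2 ^ e.1 < b %/ 2 ^ e.1 & a + b < e.2]%N.

Lemma half_block (j a : nat) : (a %/ 2 ^ j.+1 = (a %/ 2 ^ j)./2)%N.
Proof. by rewrite expnSr divnMA divn2. Qed.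

(** Partners stay within their block, so relations between blocks persist. Within a block, pairs of
    sum [e.2] are compared by this layer; for pairs of smaller sum, partners of the lower half lie
    above and partners of the upper half below, so [le_at_outward] applies. *)
Lemma known_srt e i h : (forall a b, known e a b -> le_at i h a b) ->
  forall a b, known (e.1, e.2.+1) a b -> le_at i (srt (partner e) (partner_lo e) i h) a b.
Proof.
move=> le a b; rewrite /known /= => /orP[lt|/and3P[/eqP eq lt]].
  have blk c : (partner e c %/ 2 ^ e.1.+1 = c %/ 2 ^ e.1.+1)%N.
    by case: partnerP => // d _ /andP[/eqP].
  by apply: le_at_blocks; apply: le; rewrite /known ?blk lt.
have odd_b d : siblings e.1 b d -> (d < b)%N.
  rewrite /siblings -eq => /andP[/eqP eqd ned].
  rewrite ltnNge; apply/negP => /(leq_div2r (2 ^ e.1)).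
  move: eq eqd ned lt; rewrite !half_block.
  by move: (a %/ _)%N (b %/ _)%N (d %/ _)%N => A B C; lia.
have even_a d : siblings e.1 a d -> (a < d)%N.
  rewrite /siblings => /andP[/eqP eqd ned].
  rewrite ltnNge; apply/negP => /(leq_div2r (2 ^ e.1)).
  move: eq eqd ned lt; rewrite !half_block.
  by move: (a %/ _)%N (b %/ _)%N (d %/ _)%N => A B C; lia.
rewrite ltnS leq_eqVlt => /orP[/eqP ab|ab].
  have sib : siblings e.1 a b by rewrite /siblings eq eqxx /= neq_ltn lt.
  have e_b : partner e a = b.
    by case: partnerP => [d ad _|/(_ b ab)]; [apply/val_inj => /=; lia|rewrite sib].
  by rewrite -e_b; apply: le_at_matched; rewrite e_b; apply: even_a.
apply: le_at_outward.
- by apply: le; rewrite /known eq eqxx lt ab orbT.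
- by case: partnerP => // d _ /even_a/ltnW.
- by case: partnerP => // d _ /odd_b/ltnW.
Qed.

Definition layer_sort e h := sorts (partner e) (partner_lo e) (enum 'I_n) h.

Definition all_known e h := forall i a b, known e a b -> le_at i h a b.

Lemma known_layer e h : all_known e h -> all_known (e.1, e.2.+1) (layer_sort e h).
Proof.
move=> all i; rewrite /layer_sort.
have : i \in enum 'I_n by rewrite mem_enum.
have := enum_uniq 'I_n; have := all i.
elim: (enum 'I_n) h {all} => //= k s IH h le /andP[ks us].
have keep g (K : nat -> nat -> bool) t : i \notin t -> (forall a b, K a b -> le_at i g a b) ->
    forall a b, K a b -> le_at i (sorts (partner e) (partner_lo e) t g) a b.
  elim: t g => //= l t IHt g; rewrite in_cons negb_or => /andP[il it] leg.
  by apply: IHt => // a b /leg; apply: le_at_other; rewrite eq_sym.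
rewrite in_cons; have [ik _|ik /= is_] := eqVneq i k.
  by rewrite -ik in ks *; apply: keep => //; apply: known_srt.
by apply: IH => // a b /le; apply: le_at_other; rewrite eq_sym.
Qed.

Fixpoint layers l : seq (nat * nat) :=
  if l is j.+1 then [seq (j, s) | s <- iota 0 (2 * m)] ++ layers j else [::].

Definition network l h := foldl (fun h e => layer_sort e h) h (layers l).

Lemma network_known l h :
  (forall i a b, (a %/ 2 ^ l < b %/ 2 ^ l)%N -> le_at i h a b) ->
  forall i a b, (a < b)%N -> le_at i (network l h) a b.
Proof.
rewrite /network; elim: l h => [|l IH] h le /=.
  by move=> i a b ab; apply: le; rewrite !divn1.
rewrite foldl_cat; apply: IH => i a b ab.
suff H t : all_known (l, t) (foldl (fun h e => layer_sort e h) h [seq (l, s) | s <- iota 0 t]).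
  (* Two values below [m] have sum below [2 m], so [2 m] layers complete a level. *)
  apply: (H (2 * m)%N); rewrite /known /=.
  have : (a %/ 2 ^ l.+1 <= b %/ 2 ^ l.+1)%N by rewrite !half_block half_leq// ltnW.
  rewrite leq_eqVlt => /orP[->|->//]; rewrite ab /= mul2n -addnn.
  by rewrite orbC; have := ltn_ord a; have := ltn_ord b; lia.
elim: t => [|t IHt]; first by move=> k c d /orP[|/and3P[]//]; apply: le.
rewrite -addn1 iotaD map_cat foldl_cat /= add0n addn1.
exact: (known_layer IHt).
Qed.

Lemma network_monotone l h : (m <= 2 ^ l)%N -> monotone (network l h).
Proof.
move=> ml; have le : forall i a b, (a < b)%N -> le_at i (network l h) a b.
  apply: network_known => i a b.
  by rewrite !divn_small// (leq_trans (ltn_ord _)).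
move: (network l h) le => g le; apply/forallP => x; apply/forallP => y.
apply/implyP => /forallP xy; apply/implyP => gx.
(* Interpolation from [x] to [y], one coordinate at a time. *)
pose z (k : nat) : X := [ffun j : 'I_n => if (j < k)%N then y j else x j].
have <- : z n = y by apply/ffunP => j; rewrite ffunE ltn_ord.
have gz0 : g (z 0%N) by have -> : z 0%N = x by apply/ffunP => j; rewrite ffunE.
suff H (k : nat) : (k <= n)%N -> g (z k) by apply: H.
elim: k => [//|k IH] kn; have {IH} gz := IH (ltnW kn).
pose i := Ordinal kn.
have zk : z k = upd i (x i) (z k).
  by apply/ffunP => j; rewrite !ffunE; case: eqP => [->|//]; rewrite ltnn.
have zk1 : z k.+1 = upd i (y i) (z k).
  apply/ffunP => j; rewrite !ffunE; case: eqP => [->|/eqP ji]; first by rewrite ltnSn.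
  by rewrite ltnS leq_eqVlt; have -> : (j == k :> nat) = false by apply: negbTE.
rewrite zk1; have := xy i; rewrite leq_eqVlt => /orP[/eqP/val_inj <-|lt]; first by rewrite -zk.
by apply: (le i _ _ lt); rewrite -zk.
Qed.

(** Since the later layers contract distances, each layer may be charged with how far it moves the
    original [h]. *)
Lemma hd_network l h : (hd h (network l h) <= \sum_(e <- layers l) hd h (layer_sort e h))%N.
Proof.
rewrite /network; elim: (layers l) h => [|e s IH] h /=; first by rewrite big_nil hdxx.
have contr t g g' : (hd (foldl (fun h e => layer_sort e h) g t)
    (foldl (fun h e => layer_sort e h) g' t) <= hd g g')%N.
  elim: t g g' => //= e' t IHt g g'; apply: leq_trans (IHt _ _) _.
  exact: (hd_sorts (partnerK e') (@partner_loN e')).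
apply: leq_trans (hd_triangle (foldl (fun h e => layer_sort e h) h s) _ _) _.
by rewrite big_cons addnC leq_add// ?contr// IH.
Qed.

End SortingNetwork.

(** * Rejection for a function far from sorted along one matching *)

Section StarRejection.
Variables (R : rcfType) (T : finType) (n : nat) (sg : T -> T) (lo : pred T).
Hypothesis sgK : involutive sg.
Hypothesis lo_sg : forall a, lo a -> ~~ lo (sg a).
Local Notation X := {ffun 'I_n -> T}.
Local Notation fn := {ffun X -> bool}.
Local Notation lo' := (fun a => lo (sg a)).
Hypothesis n_gt0 : (0 < n)%N.

Lemma nviolated_dual (f : fn) : nviolated sg lo' (neg_fn f) = nviolated sg lo f.
Proof.
apply: eq_bigr => i _; rewrite -[RHS](sum_flip sgK i).
by apply: eq_bigr => x _; rewrite violated_dual.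
Qed.

(** The step probability is a power of 1/2 close to the largest value that [walk_rejection_ge]
    permits. Powers of 1/2 leave only [l + 1] candidates for a tester that knows neither [K] nor
    [#|A|]. *)
Lemma star_walk_rejection (f : fn) K (A : {set X}) D l (theta : R) :
  star_family sg lo f K A D -> (0 < K <= n)%N -> (n <= 2 ^ l)%N ->
  (nviolated sg lo f)%:R <= Num.sqrt n%:R * #|X|%:R :> R ->
  0 < theta <= 1 -> 512 * l.+1%:R * n%:R <= theta * 2 ^+ l ->
  theta * #|X|%:R <= #|A|%:R * Num.sqrt (2 * K)%:R ->
  exists2 t, (t <= l)%N & theta ^+ 2 / (2048 * l.+1%:R * Num.sqrt n%:R) * #|X|%:R <=
    walk_rejection sg lo f ((2 ^+ t)^-1 : R).
Proof.
move=> star /andP[K0 Kn] nl viol /andP[th0 th1] l_large AK.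
have [X0|X0] := posnP #|X|.
  exists 0%N => //; rewrite X0 mulr0 /walk_rejection big1// => x _.
  by have : (0 < #|X|)%N; [apply/card_gt0P; exists x|rewrite X0].
have N0 : 0 < #|X|%:R :> R by rewrite ltr0n.
set N : R := #|X|%:R in viol AK N0 *.
pose a : R := #|A|%:R / N.
have AE : #|A|%:R = a * N by rewrite /a mulfVK ?gt_eqF.
have a1 : a <= 1 by rewrite ler_pdivrMr// mul1r ler_nat max_card.
have a0 : 0 <= a by rewrite divr_ge0 ?ler0n.
set r := Num.sqrt n%:R in viol *.
have r2 : r ^+ 2 = n%:R :> R by rewrite sqr_sqrtr ?ler0n.
have r1 : 1 <= r by rewrite -[leLHS]sqrtr1 ler_sqrt ?ler0n// ler1n.
have K1 : 1 <= K%:R :> R by rewrite ler1n.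
have Knr : K%:R <= n%:R :> R by rewrite ler_nat.
set l1 : R := l.+1%:R in l_large *.
have l11 : 1 <= l1 by rewrite ler1n.
have thaK : theta <= a * Num.sqrt (2 * K)%:R.
  by move: AK; rewrite AE mulrAC ler_pM2r.
have thaK2 : theta ^+ 2 <= a ^+ 2 * (2 * K%:R).
  apply: le_trans (_ : _ <= (a * Num.sqrt (2 * K)%:R) ^+ 2) _.
    by rewrite ler_sqr ?nnegrE ?(ltW th0)// mulr_ge0 ?sqrtr_ge0.
  by rewrite exprMn sqr_sqrtr ?ler0n// natrM.
have tha : theta <= 2 * a * r.
  have : theta ^+ 2 <= (2 * a * r) ^+ 2.
    have -> : (2 * a * r) ^+ 2 = 4 * (a ^+ 2 * n%:R) by rewrite -r2; ring.
    apply: le_trans thaK2 _.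
    have : 0 <= a ^+ 2 * (n%:R - K%:R) by rewrite mulr_ge0 ?sqr_ge0 ?subr_ge0.
    have : 0 <= a ^+ 2 * n%:R by rewrite mulr_ge0 ?sqr_ge0.
    lra.
  have ar0 : 0 <= a * r by rewrite mulr_ge0// (le_trans ler01).
  by rewrite ler_sqr ?nnegrE ?(ltW th0)//; lra.
have agt0 : 0 < a.
  rewrite lt_neqAle a0 andbT; apply/eqP => e; move: tha; rewrite -e mulr0 mul0r; lra.
(* The two terms are the constraints [p_deg] and [p_size] solved for [p]. *)
pose M := Num.min (1 / (8 * K%:R)) (a / (256 * l1 * r)).
have d1 : 0 < 256 * l1 * r by nra.
have d2 : 0 < 8 * K%:R :> R by lra.
have p2l : 0 < 2 ^+ l :> R by rewrite exprn_gt0.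
have lM : (2 ^+ l)^-1 <= M.
  rewrite /M le_min; apply/andP; split.
    rewrite ler_pdivlMr// mulrC ler_pdivrMr// mul1r.
    have : theta * 2 ^+ l <= 2 ^+ l by rewrite ler_piMl// ltW.
    have : n%:R <= l1 * n%:R by rewrite ler_peMl.
    lra.
  rewrite ler_pdivlMr// mulrC ler_pdivrMr//.
  have h : theta * 2 ^+ l <= 2 * a * r * 2 ^+ l by rewrite ler_wpM2r// ltW.
  rewrite -(ler_pM2r (lt_le_trans ltr01 r1)).
  have : 512 * l1 * r ^+ 2 <= 2 * (a * 2 ^+ l) * r by rewrite r2; lra.
  rewrite expr2; lra.
have M1 : M < 1.
  by rewrite /M gt_min; apply/orP; left; rewrite ltr_pdivrMr//; lra.
have [t tl /andP[pM Mp]] := exists_dyadic M1 lM.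
exists t => //; set p : R := (2 ^+ t)^-1 in pM Mp *.
have p0 : 0 <= p by rewrite invr_ge0 exprn_ge0.
move: pM; rewrite /M le_min => /andP[pK pa].
have pK8 : p * (8 * K)%:R <= 1 by rewrite natrM; move: pK; rewrite ler_pdivlMr.
have pA : p * (256 * l.+1%:R * Num.sqrt n%:R * #|X|%:R) <= #|A|%:R.
  rewrite -/l1 -/r -/N AE mulrA ler_pM2r//.
  by move: pa; rewrite ler_pdivlMr.
apply: le_trans (walk_rejection_ge sgK lo_sg n_gt0 star p0 nl viol pK8 pA K0).
have -> : p * K%:R * #|A|%:R / 2 = p * K%:R * a / 2 * N by rewrite AE; ring.
rewrite -/l1 -/r -/N ler_pM2r//.
have d3 : 0 < 2048 * l1 * r by nra.
rewrite ler_pdivrMr//.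
(* If the degree constraint binds, [p K >= 1/16] and [theta <= 2 a r] suffices. Otherwise
   [p >= a / (512 l1 r)], and [theta^2 <= 2 a^2 K] is needed. *)
have [minK|mina] := leP (1 / (8 * K%:R)) (a / (256 * l1 * r)).
  have pK1 : 1 <= 16 * (p * K%:R).
    move: Mp; rewrite /M (min_idPl minK) ler_pdivrMr//; lra.
  have th2 : theta ^+ 2 <= 2 * a * r by apply: le_trans tha; rewrite expr2 ler_piMl// ltW.
  have ar0 : 0 <= a * r by rewrite mulr_ge0// (le_trans ler01).
  have pK0 : 0 <= p * K%:R by rewrite mulr_ge0.
  have ar : a * r <= a * r * (16 * (p * K%:R)) by rewrite ler_peMr.
  have arl : a * r * (p * K%:R) <= a * r * (p * K%:R) * l1.
    by rewrite ler_peMr// mulr_ge0.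
  rewrite -mulrA in th2; apply: le_trans th2 _; move: ar arl; set u := a * r; set v := p * K%:R => ar arl.
  have -> : p * K%:R * a / 2 * (2048 * l1 * r) = 1024 * (u * v * l1) by rewrite /u /v; field.
  have : 0 <= u * v by rewrite mulr_ge0.
  lra.
have pa1 : a <= p * (512 * l1 * r).
  by move: Mp; rewrite /M (min_idPr (ltW mina)) ler_pdivrMr//; lra.
have : a * (a * K%:R) <= p * (512 * l1 * r) * (a * K%:R).
  by rewrite ler_wpM2r// mulr_ge0.
move: thaK2; lra.
Qed.

End StarRejection.

Section LayerRejection.
Variables (R : rcfType) (T : finType) (n : nat) (sg : T -> T) (lo : pred T).
Hypothesis sgK : involutive sg.
Hypothesis lo_sg : forall a, lo a -> ~~ lo (sg a).
Local Notation X := {ffun 'I_n -> T}.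
Local Notation fn := {ffun X -> bool}.
Local Notation lo' := (fun a => lo (sg a)).
Hypothesis n_gt0 : (0 < n)%N.

(** Either violated edges are so frequent that a random edge reveals one, or their number is small
    enough to bound the influence and a walk succeeds. *)
Theorem layer_rejection (f : fn) l (delta : R) :
  0 < delta <= 1 -> delta * #|X|%:R <= (hd f (sorts sg lo (enum 'I_n) f))%:R ->
  2 ^+ 15 * l.+1%:R ^+ 3 * n%:R <= delta * 2 ^+ l ->
  let theta := delta / (64 * l.+1%:R ^+ 2) in
  let target := theta ^+ 2 / (2048 * l.+1%:R * Num.sqrt n%:R) * #|X|%:R in
  target * n%:R <= (nviolated sg lo f)%:R \/
  exists2 t, (t <= l)%N & target <= walk_rejection sg lo f ((2 ^+ t)^-1 : R) \/
    target <= walk_rejection sg lo' (neg_fn f) ((2 ^+ t)^-1 : R).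
Proof.
move=> /andP[de0 de1] far l_large theta target.
set l1 : R := l.+1%:R in l_large theta target *.
have l11 : 1 <= l1 by rewrite ler1n.
have l12 : 1 <= l1 ^+ 2 by rewrite exprn_ege1.
have n1 : 1 <= n%:R :> R by rewrite ler1n.
have dl : 0 < 64 * l1 ^+ 2 by lra.
have th0 : 0 < theta by rewrite divr_gt0.
have th1 : theta <= 1 by rewrite ler_pdivrMr// mul1r; lra.
have thE : theta * (64 * l1 ^+ 2) = delta by rewrite mulfVK ?gt_eqF.
have N0 : 0 <= #|X|%:R :> R by rewrite ler0n.
have p2l : 0 < 2 ^+ l :> R by rewrite exprn_gt0.
have l_large' : 512 * l1 * n%:R <= theta * 2 ^+ l.
  have e : theta * 2 ^+ l * (64 * l1 ^+ 2) = delta * 2 ^+ l by rewrite -thE; ring.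
  rewrite -(ler_pM2r dl) e; apply: le_trans l_large.
  have -> : 512 * l1 * n%:R * (64 * l1 ^+ 2) = 2 ^+ 15 * l1 ^+ 3 * n%:R by ring.
  by [].
have nl : (n <= 2 ^ l)%N.
  rewrite -(ler_nat R) natrX; apply: le_trans (_ : _ <= theta * 2 ^+ l) _.
    by apply: le_trans l_large'; rewrite ler_peMl//; lra.
  by rewrite ler_piMl// ltW.
have [viol|viol] := lerP (Num.sqrt n%:R * #|X|%:R : R) (nviolated sg lo f)%:R.
  left; apply: le_trans viol; rewrite /target.
  set r := Num.sqrt n%:R; have r0 : 0 < r by rewrite sqrtr_gt0 ltr0n.
  have r2 : n%:R = r ^+ 2 by rewrite sqr_sqrtr ?ler0n.
  have -> : theta ^+ 2 / (2048 * l1 * r) * #|X|%:R * n%:R =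
      theta ^+ 2 * r / (2048 * l1) * #|X|%:R.
    by rewrite r2; field; rewrite !gt_eqF//; lra.
  rewrite ler_wpM2r// ler_pdivrMr; last by lra.
  have th2 : theta ^+ 2 <= 1 by rewrite exprn_ile1// ltW.
  have : theta ^+ 2 * r <= r by rewrite ler_piMl// ltW.
  have : r <= r * l1 by rewrite ler_peMr// ltW.
  lra.
right.
have [w [K [A [D [ow Kn cost_le fam]]]]] := exists_star_family sgK lo_sg R f n_gt0.
have [cov _] := orientationP _ _ _ _ ow.
have tal := directed_talagrand R sgK lo_sg cov l.
have costE : \sum_x Num.sqrt #|[pred i | w i x]|%:R = cost R w by [].
rewrite costE in tal.
have lv : (trunc_log 2 n).+1%:R <= l1.
  rewrite ler_nat ltnS -(leq_exp2l (m := 2))//; apply: leq_trans nl.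
  exact: trunc_logP.
(* The Talagrand bound loses at most [delta / 4] to its first term, by the size of [l]. What remains
   is [delta / 4 <= 16 l1^2] times the star mass per point, whence the 64 in [theta]. *)
have AK : theta * #|X|%:R <= #|A|%:R * Num.sqrt (2 * K)%:R.
  set B := #|A|%:R * _ in cost_le *.
  have B0 : 0 <= B by rewrite mulr_ge0 ?sqrtr_ge0.
  have c1 : cost R w <= 2 * l1 * B.
    by apply: le_trans cost_le _; rewrite natrM ler_wpM2r// ler_wpM2l.
  have c0 : l%:R * (8 * cost R w) <= l1 * (8 * (2 * l1 * B)).
    have cost0 : 0 <= cost R w by apply: sumr_ge0 => x _; apply: sqrtr_ge0.
    by apply: ler_pM => //; [lra|rewrite ler_nat|lra].
  have e1 : #|X|%:R * n%:R / 2 ^+ l <= #|X|%:R * (delta / 4).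
    rewrite -mulrA ler_wpM2l// ler_pdivrMr//.
    have : n%:R <= l1 ^+ 3 * n%:R by rewrite ler_peMl// exprn_ege1.
    have ll : 2 ^+ 15 * (l1 ^+ 3 * n%:R) <= delta * 2 ^+ l by rewrite mulrA.
    move: ll; set u := l1 ^+ 3 * _ => ll nu.
    have c32 : (4 : R) <= 2 ^+ 15 by rewrite -natrX ler_nat.
    have u0 : 0 <= u by apply: le_trans nu.
    have := ler_wpM2r u0 c32; lra.
  have e : theta * #|X|%:R * (64 * l1 ^+ 2) = delta * #|X|%:R by rewrite -thE; ring.
  rewrite -(ler_pM2r dl) e; move: tal far c0 e1.
  by move: (#|X|%:R * n%:R / _) (l%:R * _) => u v; rewrite expr2; lra.
have th01 : 0 < theta <= 1 by rewrite th0.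
case: fam => star.
  have [t tl le] := star_walk_rejection sgK lo_sg n_gt0 star Kn nl (ltW viol) th01 l_large' AK.
  by exists t => //; left.
have viol' : (nviolated sg lo' (neg_fn f))%:R <= Num.sqrt n%:R * #|X|%:R :> R.
  by rewrite (nviolated_dual lo sgK) ltW.
have [t tl le] := star_walk_rejection sgK (dual_lo_sg lo_sg) n_gt0 star Kn nl viol' th01 l_large' AK.
by exists t => //; right.
Qed.

End LayerRejection.

(** * Testers from pairs of points *)

Section PairTesters.
Variables (R : realType) (m n : nat).
Local Notation X := (grid m n).
Local Notation XX := (X * X)%type.
Implicit Types (nu : fdist R XX) (f : boolfun m n).

Definition upward nu := forall u, nu u != 0 -> grid_le u.1 u.2.

Definition rejection nu f := prob nu [pred u | f u.1 && ~~ f u.2].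

Lemma upward_rejection nu f : upward nu -> monotone f -> rejection nu f = 0.
Proof.
move=> nu_up /forallP fm; rewrite /rejection /prob big1// => u /andP[f1 f2].
apply/eqP; apply: contraNT f2 => /nu_up le.
by have /forallP/(_ u.2)/implyP/(_ le)/implyP/(_ f1) := fm u.1.
Qed.

Section Repeat.
Variables (nu : fdist R XX) (N : nat).

(** All pairs are queried in advance, two queries per pair; rejection occurs when some pair has
    value 1 at its first and 0 at its second point. *)
Definition repeat_algo (w : {ffun 'I_N -> XX}) : det_algo m n (N + N) :=
  ([ffun k => match split k with inl j => (w j).1 | inr j => (w j).2 end],
   [ffun ans : {ffun 'I_(N + N) -> bool} =>
     [forall j, ~~ (ans (lshift N j) && ~~ ans (rshift N j))]]).

Lemma accepts_repeat_algo f w :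
  accepts f (repeat_algo w) = [forall j, ~~ (f (w j).1 && ~~ f (w j).2)].
Proof.
rewrite /accepts ffunE; apply: eq_forallb => j; rewrite !ffunE.
by rewrite -[lshift N j]/(unsplit (inl j)) -[rshift N j]/(unsplit (inr j)) !unsplitK.
Qed.

Definition repeat_pmf (A : det_algo m n (N + N)) : R :=
  \sum_(w | repeat_algo w == A) fdist_prod nu N w.

Lemma repeat_pmf_ge0 A : 0 <= repeat_pmf A.
Proof. by apply: sumr_ge0 => w _; apply: pmf_ge0. Qed.

Lemma sum_repeat_pmf (S : pred (det_algo m n (N + N))) :
  \sum_(A | S A) repeat_pmf A = \sum_(w | S (repeat_algo w)) fdist_prod nu N w.
Proof.
rewrite [RHS](partition_big repeat_algo S)//=; apply: eq_bigr => A SA.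
by apply: eq_bigl => w; case: eqP => [->|]; rewrite ?andbT ?andbF// SA.
Qed.

Lemma repeat_pmf_sum1 : \sum_A repeat_pmf A = 1.
Proof. by rewrite (sum_repeat_pmf predT) (pmf_sum1 (fdist_prod nu N)). Qed.

Definition repeat_tester : nonadaptive_algo R m n (N + N) :=
  FDist repeat_pmf_ge0 repeat_pmf_sum1.

Lemma prob_accepts_repeat f :
  prob repeat_tester [pred A | accepts f A] = (1 - rejection nu f) ^+ N.
Proof.
rewrite /prob /= sum_repeat_pmf /=.
pose Q := [pred u : XX | ~~ (f u.1 && ~~ f u.2)].
have -> : 1 - rejection nu f = \sum_(u | Q u) nu u.
  apply/eqP; rewrite subr_eq addrC /rejection /prob -(pmf_sum1 nu).
  by rewrite (bigID [pred u | f u.1 && ~~ f u.2]).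
have -> : (\sum_(u | Q u) nu u) ^+ N = \prod_(i < N) \sum_(u | Q u) nu u.
  by rewrite prodr_const card_ord.
rewrite (bigA_distr_big Q (fun=> nu)) /=; apply: eq_bigl => w.
rewrite accepts_repeat_algo; apply/forallP/ffun_onP => w_ok j; exact: w_ok.
Qed.

Lemma prob_rejects_repeat f :
  prob repeat_tester [pred A | ~~ accepts f A] = 1 - (1 - rejection nu f) ^+ N.
Proof.
rewrite -prob_accepts_repeat -(pmf_sum1 repeat_tester) /prob.
by rewrite [in RHS](bigID [pred A | accepts f A]) /= addrAC subrr add0r.
Qed.

End Repeat.

Lemma exp1B_le_third (x : R) (N : nat) : 0 <= x <= 1 -> 2 <= N%:R * x -> (1 - x) ^+ N <= 1 / 3.
Proof.
(* A Bernoulli-type bound, proved by induction on [N]; with [N x >= 2] the second factor is at least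
   3. *)
move=> /andP[x0 x1] Nx; suff : (1 - x) ^+ N * (1 + N%:R * x) <= 1.
  have : 0 <= (1 - x) ^+ N by rewrite exprn_ge0// subr_ge0.
  nra.
elim: N {Nx} => [|N IH]; first by rewrite expr0 mul0r addr0 mulr1.
apply: le_trans IH; rewrite exprSr -mulrA ler_wpM2l//; first by rewrite exprn_ge0// subr_ge0.
rewrite -natr1; have : 0 <= N%:R * x ^+ 2 by rewrite mulr_ge0 ?ler0n ?sqr_ge0.
have := sqr_ge0 x; nra.
Qed.

Lemma rejection_itv nu f : 0 <= rejection nu f <= 1.
Proof.
rewrite /rejection /prob; apply/andP; split; first by apply: sumr_ge0 => u _; apply: pmf_ge0.
rewrite -(pmf_sum1 nu) [leRHS](bigID [pred u | f u.1 && ~~ f u.2]) /= lerDl.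
by apply: sumr_ge0 => u _; apply: pmf_ge0.
Qed.

Lemma repeat_tester_correct nu (mu : fdist R X) (eps : R) N : upward nu ->
  (forall f, far_from_monotone mu eps f -> 2 <= N%:R * rejection nu f) ->
  monotonicity_tester mu eps (repeat_tester nu N).
Proof.
move=> nu_up rej; split=> f hf.
  by rewrite prob_accepts_repeat upward_rejection// subr0 expr1n.
rewrite prob_rejects_repeat; have := exp1B_le_third (rejection_itv nu f) (rej f hf); lra.
Qed.

Section Mixture.
Variables (I : finType) (i0 : I) (nu : I -> fdist R XX).

Definition mixture_pmf u : R := (\sum_i nu i u) / #|I|%:R.

Lemma mixture_pmf_ge0 u : 0 <= mixture_pmf u.
Proof. by rewrite divr_ge0 ?ler0n// sumr_ge0// => i _; apply: pmf_ge0. Qed.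

Lemma card_gt0R : 0 < #|I|%:R :> R.
Proof. by rewrite ltr0n; apply/card_gt0P; exists i0. Qed.

Lemma mixture_pmf_sum1 : \sum_u mixture_pmf u = 1.
Proof.
rewrite -mulr_suml exchange_big /=; under eq_bigr do rewrite pmf_sum1.
by rewrite sumr_const mulfV// gt_eqF// card_gt0R.
Qed.

Definition mixture : fdist R XX := FDist mixture_pmf_ge0 mixture_pmf_sum1.

Lemma upward_mixture : (forall i, upward (nu i)) -> upward mixture.
Proof.
move=> up_nu u /=; apply: contraR => nle; rewrite /mixture_pmf big1 ?mul0r// => i _.
by apply/eqP; apply: contraNT nle; apply: up_nu.
Qed.

Lemma rejection_mixture f i : rejection (nu i) f <= #|I|%:R * rejection mixture f.
Proof.
rewrite /rejection /prob /= -mulr_suml mulrC mulfVK ?gt_eqF ?card_gt0R//.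
apply: ler_sum => u _; rewrite (bigD1 i)//= lerDl.
by apply: sumr_ge0 => k _; apply: pmf_ge0.
Qed.

End Mixture.

Section Kernel.
Variables (kappa : X -> X -> R) (m_gt0 : (0 < m)%N).
Hypothesis kappa_ge0 : forall x z, 0 <= kappa x z.
Hypothesis kappa_sum1 : forall x, \sum_z kappa x z = 1.

Definition kernel_pmf (u : XX) : R := kappa u.1 u.2 / #|X|%:R.

Lemma kernel_pmf_ge0 u : 0 <= kernel_pmf u.
Proof. by rewrite divr_ge0 ?ler0n. Qed.

Lemma card_grid_gt0 : 0 < #|X|%:R :> R.
Proof.
rewrite ltr0n; apply/card_gt0P.
by exists [ffun=> Ordinal m_gt0].
Qed.

Lemma kernel_pmf_sum1 : \sum_u kernel_pmf u = 1.
Proof.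
rewrite -(pair_bigA _ (fun x z => kernel_pmf (x, z))) /=.
under eq_bigr => x _ do rewrite -mulr_suml kappa_sum1.
by rewrite -mulr_suml sumr_const mulfV// gt_eqF// card_grid_gt0.
Qed.

Definition kernel : fdist R XX := FDist kernel_pmf_ge0 kernel_pmf_sum1.

Lemma kernel_swap_pmf_sum1 : \sum_u kernel_pmf (u.2, u.1) = 1.
Proof.
rewrite -kernel_pmf_sum1 [RHS](reindex_inj (h := fun u => (u.2, u.1)))//.
by move=> [? ?] [? ?] [-> ->].
Qed.

(** For walks that go down: the end point is listed first, so that the pair is upward. *)
Definition kernel_swap : fdist R XX :=
  FDist (fun u => kernel_pmf_ge0 (u.2, u.1)) kernel_swap_pmf_sum1.

Lemma rejection_kernel f : rejection kernel f =
  (\sum_x (f x)%:R * \sum_z kappa x z * (~~ f z)%:R) / #|X|%:R.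
Proof.
rewrite /rejection /prob big_mkcond /= mulr_suml.
rewrite -(pair_bigA _ (fun x z => if f x && ~~ f z then kernel_pmf (x, z) else 0)) /=.
apply: eq_bigr => x _; rewrite mulr_sumr mulr_suml; apply: eq_bigr => z _.
by rewrite /kernel_pmf /=; case: (f x); case: (f z); rewrite /= ?(mul0r, mulr0, mul1r, mulr1).
Qed.

Lemma rejection_kernel_swap f : rejection kernel_swap f =
  (\sum_x (~~ f x)%:R * \sum_z kappa x z * (f z)%:R) / #|X|%:R.
Proof.
rewrite /rejection /prob big_mkcond /= mulr_suml.
rewrite -(pair_bigA _ (fun z x => if f z && ~~ f x then kernel_pmf (x, z) else 0)) /=.
rewrite exchange_big; apply: eq_bigr => x _ /=; rewrite mulr_sumr mulr_suml; apply: eq_bigr => z _.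
by rewrite /kernel_pmf /=; case: (f x); case: (f z); rewrite /= ?(mul0r, mulr0, mul1r, mulr1).
Qed.

End Kernel.
End PairTesters.

Section WalkKernel.
Variables (R : rcfType) (T : finType) (n : nat) (sg : T -> T) (lo : pred T).
Local Notation X := {ffun 'I_n -> T}.
Local Notation walk := (walk sg lo).
Implicit Types (s : seq 'I_n) (x z : X).

Lemma walk_sum (p : R) s F x : walk p s F x = \sum_z walk p s (fun y => (y == z)%:R) x * F z.
Proof.
elim: s x => /= [|i s IH] x.
  rewrite (bigD1 x)//= eqxx mul1r big1 ?addr0// => z zx.
  by rewrite eq_sym (negbTE zx) mul0r.
rewrite !IH !mulr_sumr -big_split /=; apply: eq_bigr => z _; ring.
Qed.

Lemma walk_support (p : R) (le : rel X) s x z : reflexive le -> transitive le ->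
  (forall i y, le y (up sg lo i y)) -> walk p s (fun y => (y == z)%:R) x != 0 -> le x z.
Proof.
move=> le_refl le_trans le_up; elim: s x => /= [|i s IH] x.
  by have [->|] := eqVneq x z; rewrite ?eqxx.
have [/IH->//|/negPn/eqP->] := boolP (walk p s (fun y => (y == z)%:R) x != 0).
rewrite mulr0 add0r mulf_eq0 negb_or => /andP[_ /IH].
exact: le_trans (le_up i x).
Qed.

End WalkKernel.

(** * The tester on the grid *)

Section GridTester.
Variables (R : realType) (m n : nat).
Hypotheses (m_gt0 : (0 < m)%N) (n_gt0 : (0 < n)%N).
Local Notation X := (grid m n).
Local Notation XX := (X * X)%type.
Local Notation fn := (boolfun m n).
Implicit Types (f : fn) (e : nat * nat) (i : 'I_n).

Lemma grid_le_refl : reflexive (@grid_le m n).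
Proof. by move=> x; apply/forallP. Qed.

Lemma grid_le_trans : transitive (@grid_le m n).
Proof.
move=> y x z /forallP xy /forallP yz; apply/forallP => i.
exact: leq_trans (xy i) (yz i).
Qed.

Lemma grid_le_up e i (x : X) : grid_le x (up (partner e) (partner_lo e) i x).
Proof.
rewrite /up; case: ifP => [lo|_]; last exact: grid_le_refl.
by apply/forallP => j; rewrite ffunE; case: eqP => // ->; apply: ltnW.
Qed.

Lemma grid_le_down e i (x : X) :
  grid_le (up (partner e) (fun a => partner_lo e (partner e a)) i x) x.
Proof.
rewrite /up; case: ifP => [lo|_]; last exact: grid_le_refl.
apply/forallP => j; rewrite ffunE; case: eqP => // ->.
by move: lo; rewrite /lower /partner_lo partnerK => /ltnW.
Qed.

Definition edge_kernel e (x z : X) : R :=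
  (\sum_i (up (partner e) (partner_lo e) i x == z)%:R) / n%:R.

Lemma sum_eq_indicator (F : X -> R) y : \sum_z (y == z)%:R * F z = F y.
Proof.
rewrite (bigD1 y)//= eqxx mul1r big1 ?addr0// => z zy.
by rewrite eq_sym (negbTE zy) mul0r.
Qed.

Lemma sum_edge_kernel e (F : X -> R) x : \sum_z edge_kernel e x z * F z =
  (\sum_i F (up (partner e) (partner_lo e) i x)) / n%:R.
Proof.
under eq_bigr do rewrite /edge_kernel mulrAC mulr_suml.
rewrite -mulr_suml exchange_big; congr (_ / _).
by apply: eq_bigr => i _; rewrite sum_eq_indicator.
Qed.

Lemma edge_kernel_ge0 e x z : 0 <= edge_kernel e x z.
Proof. by rewrite divr_ge0 ?ler0n// sumr_ge0. Qed.

Lemma edge_kernel_sum1 e x : \sum_z edge_kernel e x z = 1.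
Proof.
have := sum_edge_kernel e (fun=> 1) x; under eq_bigr do rewrite mulr1.
by rewrite sumr_const card_ord mulfV// pnatr_eq0 -lt0n.
Qed.

Definition dyadic t : R := (2 ^+ t)^-1.

Lemma dyadic_ge0 t : 0 <= dyadic t.
Proof. by rewrite invr_ge0 exprn_ge0. Qed.

Lemma dyadic_le1 t : dyadic t <= 1.
Proof. by rewrite invf_le1 ?exprn_gt0// exprn_ege1// ler1n. Qed.

Section Direction.
Variables (e : nat * nat) (lo : pred 'I_m) (t : nat).

Definition walk_kernel (x z : X) : R :=
  walk (partner e) lo (dyadic t) (enum 'I_n) (fun y => (y == z)%:R) x.

Lemma walk_kernel_ge0 x z : 0 <= walk_kernel x z.
Proof. by apply: walk_ge0; rewrite ?dyadic_ge0 ?dyadic_le1. Qed.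

Lemma walk_kernel_sum1 x : \sum_z walk_kernel x z = 1.
Proof.
rewrite -(walk_cst (partner e) lo (dyadic t) (enum 'I_n) 1 x) [RHS]walk_sum.
by apply: eq_bigr => z _; rewrite mulr1.
Qed.

End Direction.

(** [None] tests a random edge of the layer; [Some (t, b)] is a walk with step probability [2^-t],
    upwards if [b] holds and downwards otherwise. *)
Definition trial e (c : option (nat * bool)) : fdist R XX :=
  match c with
  | None => kernel m_gt0 (edge_kernel_ge0 e) (edge_kernel_sum1 e)
  | Some (t, true) => kernel m_gt0 (walk_kernel_ge0 e (partner_lo e) t)
      (walk_kernel_sum1 e (partner_lo e) t)
  | Some (t, false) =>
      kernel_swap m_gt0 (walk_kernel_ge0 e (fun a => partner_lo e (partner e a)) t)
      (walk_kernel_sum1 e (fun a => partner_lo e (partner e a)) t)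
  end.

Lemma upward_trial e c : upward (trial e c).
Proof.
case: c => [[t []]|] [x z] /=; rewrite /kernel_pmf mulf_eq0 negb_or /= => /andP[+ _].
- by apply: walk_support; [exact: grid_le_refl|exact: grid_le_trans|exact: grid_le_up].
- move=> k0; apply: (@walk_support _ _ _ _ _ _ (fun x z => grid_le z x) _ _ _ _ _ _ k0).
  + exact: grid_le_refl.
  + by move=> ? ? ? ? ?; apply: grid_le_trans; eassumption.
  + exact: grid_le_down.
rewrite mulf_eq0 negb_or => /andP[+ _]; apply: contraR => nle.
rewrite big1// => i _; case: eqP => // e'; move: nle; rewrite -e'.
by rewrite grid_le_up.
Qed.

Lemma rejection_edge f e : rejection (trial e None) f =
  (nviolated (partner e) (partner_lo e) f)%:R / n%:R / #|X|%:R.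
Proof.
rewrite rejection_kernel; congr (_ / _).
under eq_bigr do rewrite sum_edge_kernel mulrA.
rewrite -mulr_suml; congr (_ / _); rewrite natr_sum.
under [LHS]eq_bigr do rewrite mulr_sumr.
rewrite exchange_big; apply: eq_bigr => i _; rewrite natr_sum; apply: eq_bigr => x _ /=.
rewrite /violated /up -natrM mulnb; case: ifP => //= _.
by rewrite andbN.
Qed.

Lemma rejection_walk_up f e t : rejection (trial e (Some (t, true))) f =
  walk_rejection (partner e) (partner_lo e) f (dyadic t) / #|X|%:R.
Proof.
rewrite rejection_kernel; congr (_ / _); apply: eq_bigr => x _.
by rewrite [in RHS]walk_sum.
Qed.

Lemma rejection_walk_down f e t : rejection (trial e (Some (t, false))) f =
  walk_rejection (partner e) (fun a => partner_lo e (partner e a)) (neg_fn f) (dyadic t) / #|X|%:R.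
Proof.
rewrite rejection_kernel_swap; congr (_ / _); apply: eq_bigr => x _.
rewrite [in RHS]walk_sum ffunE; congr (_ * _); apply: eq_bigr => z _.
by rewrite ffunE negbK.
Qed.

Lemma disagreement_uniform f g :
  disagreement (fdist_prod (uniform R m_gt0) n) f g = (hd f g)%:R / #|X|%:R.
Proof.
rewrite /disagreement /prob /= /prod_pmf /uniform_pmf.
under eq_bigr do rewrite prodr_const card_ord.
rewrite sumr_const card_ffun !card_ord natrX exprVn.
by rewrite -[LHS]mulr_natl.
Qed.

Lemma sum_layers (F : nat * nat -> nat) l : (\sum_(e <- layers m l) F e =
  \sum_(js : 'I_l * 'I_(2 * m)) F (val js.1, val js.2))%N.
Proof.
rewrite -(pair_bigA _ (fun (j : 'I_l) (s : 'I_(2 * m)) => F (val j, val s))) /=.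
elim: l => [|l IH] /=; first by rewrite big_nil big_ord0.
rewrite big_cat big_map IH big_ord_recr /= addnC; congr (_ + _)%N.
have -> : iota 0 (2 * m) = index_iota 0 (2 * m) by rewrite /index_iota subn0.
by rewrite big_mkord.
Qed.

(** The network makes [f] monotone, so its layers together move [f] by at least [eps], and one of
    them by at least the average. *)
Lemma far_layer f (eps : R) l : (m <= 2 ^ l)%N -> (0 < l)%N ->
  far_from_monotone (fdist_prod (uniform R m_gt0) n) eps f -> 0 < eps ->
  exists js : 'I_l * 'I_(2 * m), let e := (val js.1, val js.2) in
    eps / (2 * m * l.+1)%:R * #|X|%:R <= (hd f (layer_sort e f))%:R.
Proof.
move=> ml l0 far eps0.
have X0 : 0 < #|X|%:R :> R := card_grid_gt0 R n m_gt0.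
have le : eps * #|X|%:R <= \sum_(js : 'I_l * 'I_(2 * m)) (hd f (layer_sort (val js.1, val js.2) f))%:R.
  rewrite -natr_sum -(sum_layers (fun e => hd f (layer_sort e f))).
  apply: le_trans (_ : _ <= (hd f (network l f))%:R) _; last by rewrite ler_nat hd_network.
  rewrite -ler_pdivlMr// -disagreement_uniform; apply: le_trans far _.
  by apply: (dist_monotoneP _ f).2; apply: network_monotone.
have m2 : (0 < 2 * m)%N by rewrite muln_gt0.
have [js {}le] := exists_ge_mean (Ordinal l0, Ordinal m2) le.
exists js => /=; rewrite mulrAC ler_pdivrMr ?ltr0n ?muln_gt0 ?m_gt0//.
apply: le_trans le _; rewrite mulrC ler_wpM2l//.
rewrite card_prod !card_ord ler_nat mulnC leq_mul2l leqnSn orbT //.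
Qed.

(** The bound of [layer_rejection] for [delta = eps / (2 m (l + 1))], the share of a single
    layer. *)
Definition rejection_bound (eps : R) l : R :=
  let theta := eps / (2 * m * l.+1)%:R / (64 * l.+1%:R ^+ 2) in
  theta ^+ 2 / (2048 * l.+1%:R * Num.sqrt n%:R).

Lemma large_log (eps : R) l : 0 < eps <= 1 ->
  2 ^+ 16 * l.+1%:R ^+ 4 * n%:R * m%:R <= eps * 2 ^+ l ->
  (m <= 2 ^ l)%N /\ (0 < l)%N.
Proof.
move=> /andP[eps0 eps1] l_large.
have m1 : 1 <= m%:R :> R by rewrite ler1n.
have n1 : 1 <= n%:R :> R by rewrite ler1n.
have l11 : 1 <= l.+1%:R :> R by rewrite ler1n.
have l14 : 1 <= l.+1%:R ^+ 4 :> R by rewrite exprn_ege1.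
have ml : 2 ^+ 16 * m%:R <= 2 ^+ l :> R.
  apply: le_trans (_ : _ <= eps * 2 ^+ l) _; last by rewrite ler_piMl ?exprn_ge0.
  apply: le_trans l_large; move: l14; set L4 := _ ^+ 4; set P : R := 2 ^+ 16 => l14.
  have -> : P * L4 * n%:R * m%:R = P * m%:R * (L4 * n%:R) by ring.
  rewrite ler_peMr//; first by rewrite mulr_ge0 ?exprn_ge0.
  by rewrite -[leLHS]mulr1 ler_pM.
have {}ml : (2 ^ 16 * m <= 2 ^ l)%N by rewrite -(ler_nat R) natrM !natrX.
have m2l : (m <= 2 ^ l)%N by apply: leq_trans ml; rewrite leq_pmull// expn_gt0.
split=> //; case: (l) ml => // ml.
have : (2 ^ 16 * 1 <= 1)%N by apply: leq_trans ml; rewrite leq_mul2l m_gt0 orbT.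
by rewrite muln1 leqNgt -{1}(expn0 2) ltn_exp2l.
Qed.

Lemma far_trial f (eps : R) l : 0 < eps <= 1 ->
  2 ^+ 16 * l.+1%:R ^+ 4 * n%:R * m%:R <= eps * 2 ^+ l ->
  far_from_monotone (fdist_prod (uniform R m_gt0) n) eps f ->
  exists (js : 'I_l * 'I_(2 * m)) (c : option ('I_l.+1 * bool)),
    rejection_bound eps l <=
    rejection (trial (val js.1, val js.2) (omap (fun tb => (val tb.1, tb.2)) c)) f.
Proof.
move=> eps01 l_large far.
have [m2l l0] := large_log eps01 l_large; have /andP[eps0 eps1] := eps01.
have [js le] := far_layer m2l l0 far eps0.
set e := (val js.1, val js.2) in le *; set delta := eps / _ in le.
have d0 : 0 < (2 * m * l.+1)%:R :> R by rewrite ltr0n !muln_gt0 m_gt0.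
have delta0 : 0 < delta by rewrite divr_gt0.
have delta1 : delta <= 1.
  rewrite ler_pdivrMr// mul1r (le_trans eps1)// ler1n !muln_gt0 m_gt0//.
have delta01 : 0 < delta <= 1 by rewrite delta0.
have l_large' : 2 ^+ 15 * l.+1%:R ^+ 3 * n%:R <= delta * 2 ^+ l.
  rewrite -(ler_pM2r d0); apply: le_trans (_ : _ <= eps * 2 ^+ l) _.
    by apply: le_trans l_large; rewrite !natrM le_eqVlt; apply/orP; left; apply/eqP; ring.
  by rewrite /delta mulrAC mulfVK ?gt_eqF.
have X0 : 0 < #|X|%:R :> R := card_grid_gt0 R n m_gt0.
exists js; rewrite -/e.
have [viol|[t tl [walk|walk]]] := layer_rejection (partnerK e) (@partner_loN _ e) n_gt0 delta01 le l_large'.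
- by exists None; rewrite rejection_edge ler_pdivlMr// ler_pdivlMr// ltr0n.
- have tl' : (t < l.+1)%N by [].
  by exists (Some (Ordinal tl', true)); rewrite rejection_walk_up ler_pdivlMr.
- have tl' : (t < l.+1)%N by [].
  by exists (Some (Ordinal tl', false)); rewrite rejection_walk_down ler_pdivlMr.
Qed.

(** The successful layer and trial depend on [f], so they are drawn uniformly, at the price of the
    number of choices. *)
Lemma grid_trial (eps : R) l : 0 < eps <= 1 ->
  2 ^+ 16 * l.+1%:R ^+ 4 * n%:R * m%:R <= eps * 2 ^+ l ->
  exists2 nu : fdist R XX, upward nu & forall f,
    far_from_monotone (fdist_prod (uniform R m_gt0) n) eps f ->
    rejection_bound eps l <= (l * (2 * m) * (2 * l.+1).+1)%:R * rejection nu f.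
Proof.
move=> eps01 l_large.
pose I : finType := (('I_l * 'I_(2 * m)) * option ('I_l.+1 * bool))%type.
pose nu (k : I) := trial (val k.1.1, val k.1.2) (omap (fun tb => (val tb.1, tb.2)) k.2).
have cardI : #|{: I}| = (l * (2 * m) * (2 * l.+1).+1)%N.
  by rewrite !card_prod card_option card_prod card_bool !card_ord [(_ * 2)%N]mulnC.
have [_ l0] := large_log eps01 l_large.
have m2 : (0 < 2 * m)%N by rewrite muln_gt0.
pose i0 : I := ((Ordinal l0, Ordinal m2), None).
exists (mixture i0 nu) => [|f far].
  by apply: upward_mixture => k; apply: upward_trial.
have [js [c le]] := far_trial eps01 l_large far.
by apply: le_trans le _; rewrite -cardI; apply: (rejection_mixture i0 nu f (js, c)).
Qed.

End GridTester.

(** * Choice of parameters and number of queries *)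

Section Numerics.
Variable R : realType.

(** After bounding each factor by a power of 2, the exponents satisfy
    [16 + 4 (7 + b) + b <= 64 b]. *)
Lemma expn_dominates b W : (0 < b)%N -> (W <= 2 ^ b)%N ->
  (2 ^ 16 * (64 * b).+1 ^ 4 * W <= 2 ^ (64 * b))%N.
Proof.
move=> b0 Wb.
have b2 : (b <= 2 ^ b)%N by rewrite ltnW// ltn_expl.
have l2 : ((64 * b).+1 <= 2 ^ (7 + b))%N.
  rewrite expnD; apply: leq_trans (leq_mul (leqnn _) b2).
  by have -> : (2 ^ 7 = 128)%N by []; lia.
apply: leq_trans (_ : _ <= 2 ^ 16 * (2 ^ (7 + b)) ^ 4 * 2 ^ b)%N _.
  by rewrite leq_mul// leq_mul2l leq_exp2r// l2 orbT.
by rewrite -expnM -!expnD leq_exp2l//; lia.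
Qed.

Lemma log_factor_ge n m (eps : R) : (0 < n)%N -> (0 < m)%N -> 0 < eps <= 1 ->
  2 * ln 2 <= log_factor n m eps.
Proof.
move=> n0 m0 /andP[e0 e1]; rewrite /log_factor.
have ln2 (x : R) : 1 <= x -> ln 2 <= ln (1 + x).
  by move=> x1; rewrite ler_ln ?posrE//; lra.
have := ln2 _ (_ : 1 <= n%:R); have := ln2 _ (_ : 1 <= m%:R); have := ln2 _ (_ : 1 <= eps^-1).
rewrite !ler1n invf_ge1// => /(_ e1) h1 /(_ m0) h2 /(_ n0) h3.
have : 0 < ln 2 :> R by rewrite ln_gt0// ltr1n.
lra.
Qed.

Lemma up_log_le_log_factor n m (eps : R) : (0 < n)%N -> (0 < m)%N -> 0 < eps <= 1 ->
  (up_log 2 (n * m * (Num.truncn eps^-1).+1)).+1%:R <= 2 / ln 2 * log_factor n m eps.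
Proof.
move=> n0 m0 eps01; have lf := log_factor_ge n0 m0 eps01.
have /andP[e0 e1] := eps01.
have ln2 : 0 < ln 2 :> R by rewrite ln_gt0// ltr1n.
rewrite mulrAC ler_pdivlMr//.
set e := (Num.truncn _).+1; set W := (n * m * e)%N.
have [W1|W1] := leqP W 1.
  have -> : up_log 2 W = 0%N by apply/eqP; rewrite up_log_eq0; lia.
  by rewrite mul1r; lra.
have /andP[uW _] := up_log_bounds (isT : 1 < 2)%N W1.
have u0 : (0 < up_log 2 W)%N by rewrite up_log_gt0.
move: uW u0; case: (up_log 2 W) => // u /= uW _.
have nR : 0 < n%:R :> R by rewrite ltr0n.
have mR : 0 < m%:R :> R by rewrite ltr0n.
have eR : 0 < e%:R :> R by rewrite ltr0n.
have lnW : ln (W%:R : R) <= log_factor n m eps.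
  rewrite !natrM !lnM ?posrE ?mulr_gt0//; apply: lerD; first apply: lerD.
  - by rewrite ler_ln ?posrE//; lra.
  - by rewrite ler_ln ?posrE//; lra.
  have e_le : e%:R <= 1 + eps^-1.
    by rewrite /e -natr1 addrC lerD2l truncn_le invr_ge0 ltW.
  by rewrite ler_ln ?posrE// (lt_le_trans eR).
have : u%:R * ln 2 <= ln (W%:R : R).
  rewrite mulr_natl -lnXn ?ltr0n// ler_ln ?posrE ?exprn_gt0 ?ltr0n ?(ltnW W1)//.
  by rewrite -natrX ler_nat ltnW.
(* The left side is [u + 2]: [u ln 2] is at most the log factor by the bound on [W], and [2 ln 2] is
   at most another one. *)
rewrite -[u.+2%:R]natr1 -[u.+1%:R]natr1; lra.
Qed.

End Numerics.

(** The square of [theta] yields [m^2 / eps^2]; drawing the layer yields the third factor [m]. Of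
    the nine logarithmic factors, seven come from the rejection bound and two from the number of
    trials. *)
Lemma query_bound (R : realType) (m n l : nat) (eps : R) : (0 < m)%N -> (0 < n)%N -> 0 < eps <= 1 ->
  let Y := 12 * 2 ^+ 25 * l.+1%:R ^+ 9 * (Num.sqrt n%:R * m%:R ^+ 3 / eps ^+ 2) in
  1 <= Y /\ forall rho : R,
    rejection_bound m n eps l <= (l * (2 * m) * (2 * l.+1).+1)%:R * rho -> 2 <= Y * rho.
Proof.
move=> m0 n0 /andP[eps0 eps1] Y.
have m1 : 1 <= m%:R :> R by rewrite ler1n.
have l1 : 1 <= l.+1%:R :> R by rewrite ler1n.
set r : R := Num.sqrt n%:R in Y *.
have r1 : 1 <= r by rewrite -[leLHS]sqrtr1 ler_sqrt ?ler0n// ler1n.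
have rbE : rejection_bound m n eps l =
    eps ^+ 2 / (2 ^+ 25 * m%:R ^+ 2 * l.+1%:R ^+ 7 * r).
  rewrite /rejection_bound -/r !natrM.
  by field; rewrite !gt_eqF//; lra.
have YE : Y * eps ^+ 2 = 12 * 2 ^+ 25 * l.+1%:R ^+ 9 * r * m%:R ^+ 3.
  by rewrite /Y -/r; field; rewrite gt_eqF.
have eps2 : 0 < eps ^+ 2 by rewrite exprn_gt0.
have D0 : 0 < 2 ^+ 25 * m%:R ^+ 2 * l.+1%:R ^+ 7 * r.
  by rewrite !mulr_gt0 ?exprn_gt0//; lra.
split.
  rewrite -(ler_pM2r eps2) YE mul1r; apply: (@le_trans _ _ 1); first by rewrite exprn_ile1// ltW.
  by rewrite !mulr_ege1 ?exprn_ege1//; lra.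
move=> rho; rewrite rbE => le.
have rho0 : 0 <= rho.
  rewrite leNgt; apply/negP => rho0; have : 0 < eps ^+ 2 / (2 ^+ 25 * m%:R ^+ 2 * l.+1%:R ^+ 7 * r) by rewrite divr_gt0.
  move/(lt_le_trans)/(_ le); apply/negP; rewrite -leNgt; apply: mulr_ge0_le0; [exact: ler0n|exact: ltW].
have sizeI : (l * (2 * m) * (2 * l.+1).+1)%:R <= 6 * m%:R * l.+1%:R ^+ 2 :> R.
  rewrite -[6]/(6%:R) -natrX -!natrM ler_nat.
  by move: l.+1 (leqnSn l) (ltn0Sn l) => k lk k0; nia.
rewrite -(ler_pM2r eps2) mulrAC YE.
move: le; rewrite ler_pdivrMr// => le.
have : (l * (2 * m) * (2 * l.+1).+1)%:R * rho <= 6 * m%:R * l.+1%:R ^+ 2 * rho by rewrite ler_wpM2r.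
set D := _ * r in le D0.
move=> /(fun h => ler_wpM2r (ltW D0) h) /(le_trans le) {}le.
have -> : 12 * 2 ^+ 25 * l.+1%:R ^+ 9 * r * m%:R ^+ 3 * rho = 2 * (6 * m%:R * l.+1%:R ^+ 2 * rho * D).
  by rewrite /D; ring.
lra.
Qed.

Theorem theorem1p2 (R : realType) :
  exists (C : R) (k : nat),
    forall (m n : nat) (m_gt0 : (0 < m)%N) (eps : R), 0 < eps -> eps <= 1 ->
      exists (q : nat) (P : nonadaptive_algo R m n q),
        q%:R <= C * log_factor n m eps ^+ k *
                (Num.sqrt n%:R * m%:R ^+ 3 / eps ^+ 2) /\
        monotonicity_tester (fdist_prod (uniform R m_gt0) n) eps P.
Proof.
exists (48 * 2 ^+ 25 * (65 * (2 / ln 2)) ^+ 9), 9%N => m n m_gt0 eps eps0 eps1.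
(* For [n = 0] the grid is a single point, every function is monotone, and zero queries suffice. *)
have [->|n_gt0] := posnP n.
  pose x0 : grid m 0 * grid m 0 := ([ffun=> Ordinal m_gt0], [ffun=> Ordinal m_gt0]).
  have sum1 : \sum_u (u == x0)%:R = 1 :> R.
    by rewrite (bigD1 x0)//= eqxx big1 ?addr0// => u /negbTE->.
  pose nu : fdist R (grid m 0 * grid m 0)%type := FDist (fun u => ler0n R _) sum1.
  exists 0%N, (repeat_tester nu 0); rewrite sqrtr0 !mul0r mulr0; split=> //.
  apply: (@repeat_tester_correct R m 0 nu _ eps 0) => [u _|f].
    by apply/forallP => -[].
  rewrite /far_from_monotone => far; exfalso.
  have fm : monotone f.
    apply/forallP => x; apply/forallP => y; apply/implyP => _.
    have -> : x = y by apply/ffunP => -[].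
    by rewrite implybb.
  have := (dist_monotoneP (fdist_prod (uniform R m_gt0) 0) f).2 f fm.
  rewrite disagreement_uniform hdxx mul0r => le0.
  by have := lt_le_trans eps0 (le_trans far le0); rewrite ltxx.
have eps01 : 0 < eps <= 1 by rewrite eps0.
pose e := (Num.truncn eps^-1).+1; pose W := (n * m * e)%N.
(* The successor makes [b] positive; 64 is the constant of [expn_dominates]. *)
pose b := (up_log 2 W).+1; pose l := (64 * b)%N.
have Wb : (W <= 2 ^ b)%N.
  by apply: leq_trans (up_logP W (isT : 1 < 2)%N) _; rewrite leq_exp2l.
have l_large : 2 ^+ 16 * l.+1%:R ^+ 4 * n%:R * m%:R <= eps * 2 ^+ l.
  have e_ge : eps^-1 <= e%:R by rewrite ltW// truncnS_gt.
  have := expn_dominates (ltn0Sn _) Wb; rewrite -/l -(ler_nat R) 2!natrM !natrX => le.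
  have eps_e : 1 <= eps * e%:R by rewrite -ler_pdivrMl ?mulr1.
  rewrite /W !natrM in le.
  set P : R := _ * n%:R * m%:R; have P0 : 0 <= P by rewrite !mulr_ge0 ?exprn_ge0.
  apply: le_trans (ler_peMr P0 eps_e) _.
  have -> : P * (eps * e%:R) = eps * (2 ^+ 16 * l.+1%:R ^+ 4 * (n%:R * m%:R * e%:R)).
    by rewrite /P; ring.
  by rewrite ler_pM2l.
have [nu nu_up rej] := grid_trial m_gt0 n_gt0 eps01 l_large.
have [Y1 Yrej] := query_bound l m_gt0 n_gt0 eps01.
set Y := _ * _ in Y1 Yrej.
exists _, (repeat_tester nu (Num.truncn Y).+1); split; last first.
  apply: repeat_tester_correct => // f /rej /Yrej YY.
  apply: le_trans YY _; rewrite ler_wpM2r ?(ltW (truncnS_gt _))//.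
  by have /andP[] := rejection_itv nu f.
have lf_ge0 : 0 <= log_factor n m eps.
  apply: le_trans (log_factor_ge n_gt0 m_gt0 eps01).
  by rewrite mulr_ge0// ltW// ln_gt0// ltr1n.
have l_le : l.+1%:R <= 65 * (2 / ln 2) * log_factor n m eps.
  apply: (@le_trans _ _ (65 * b%:R)); first by rewrite -natrM ler_nat /l; lia.
  by rewrite -mulrA ler_pM2l// up_log_le_log_factor.
have Z0 : 0 <= Num.sqrt n%:R * m%:R ^+ 3 / eps ^+ 2.
  by rewrite divr_ge0 ?mulr_ge0 ?sqrtr_ge0 ?exprn_ge0// ltW.
(* Two queries per repetition: [2 (trunc Y + 1) <= 2 Y + 2 <= 4 Y], as [1 <= Y]. *)
apply: (@le_trans _ _ (4 * Y)).
  have := truncn_le Y; rewrite (le_trans ler01 Y1) natrD -natr1 => /idP tY.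
  lra.
rewrite /Y mulrA ler_wpM2r//.
have : l.+1%:R ^+ 9 <= (65 * (2 / ln 2) * log_factor n m eps) ^+ 9.
  by rewrite lerXn2r ?nnegrE// (le_trans _ l_le).
rewrite exprMn; set L9 := l.+1%:R ^+ 9; set K9 := _ ^+ 9; set F9 := _ ^+ 9 => LK.
have -> : 48 * 2 ^+ 25 * K9 * F9 = 4 * (12 * 2 ^+ 25) * (K9 * F9) by ring.
by rewrite mulrA ler_wpM2l// !mulr_ge0 ?exprn_ge0.
Qed.
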